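(* Let $T>0$ and let $u(x,t)$ be a solution of problem (P) (defined in the context) in $Q_T$. (i) If $u_0(x)\not\equiv 0$ in $\Omega$ and $m\ge 1$, then $u(x,t)>0$ in $Q_T\cup S_T$. (ii) If $u_0(x)>0$ in $\overline\Omega$ and $p<m<1$, then $u(x,t)>0$ in $Q_T\cup\Gamma_T$.
   Context: Let $n\ge 1$, let $\Omega\subset\mathbb{R}^n$ be a bounded domain with smooth boundary $\partial\Omega$, and let $\nu$ be the unit outward normal on $\partial\Omega$. Let $p\ge 0$, $q>0$, $m>0$, $l>0$, $a>0$, $b>0$ be constants (for $p=0$, $u^p$ is understood as $1$). Let $k\in C(\partial\Omega\times\overline\Omega\times[0,+\infty))$ with $k(x,y,t)\ge 0$, and let $u_0\in C^1(\overline\Omega)$ satisfy $u_0(x)\ge 0$ in $\Omega$ and $\frac{\partial u_0(x)}{\partial\nu}=\int_\Omega k(x,y,0)u_0^l(y)\,dy$ on $\partial\Omega$. For $T>0$ put $Q_T=\Omega\times(0,T)$, $S_T=\partial\Omega\times(0,T)$, $\Gamma_T=S_T\cup(\overline\Omega\times\{0\})$. Problem (P): $$u_t=\Delta u+a u^p\int_0^t u^q(x,\tau)\,d\tau-bu^m,\quad x\in\Omega,\ t>0,$$ $$\frac{\partial u(x,t)}{\partial\nu}=\int_\Omega k(x,y,t)u^l(y,t)\,dy,\quad x\in\partial\Omega,\ t>0,$$ $$u(x,0)=u_0(x),\quad x\in\Omega.$$ A solution of (P) in $Q_T$ is a nonnegative function $u\in C^{2,1}(Q_T)\cap C^{1,0}(Q_T\cup\Gamma_T)$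 satisfying the equation for $(x,t)\in Q_T$, the boundary condition for $(x,t)\in S_T$, and the initial condition for $x\in\Omega$. *)

(* Defs.v *)
(* Points of R^n are row vectors ['rV[R]_n] over an arbitrary [R : realType]. *)
From HB Require Import structures.
From mathcomp Require Import all_boot all_order all_algebra.
From mathcomp Require Import all_classical all_reals all_analysis.
Set Implicit Arguments.
Unset Strict Implicit.
Unset Printing Implicit Defensive.
Import Order.TTheory GRing.Theory Num.Theory.
Import numFieldNormedType.Exports.
Local Open Scope classical_set_scope.
Local Open Scope ring_scope.

Section LebesgueRn.
Context {R : realType}.

Definition swap_cons n (p : n.-tuple (measurableTypeR R) * measurableTypeR R) :
  n.+1.-tuple (measurableTypeR R) := [tuple of p.2 :: p.1].

Lemma measurable_swap_cons n : measurable_fun [set: _] (@swap_cons n).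
Proof. exact: measurable_cons. Qed.

Section step.
Variable n : nat.
Variable mu : {measure set (n.-tuple (measurableTypeR R)) -> \bar R}.

Definition lebesgue_step : set (n.+1.-tuple (measurableTypeR R)) -> \bar R :=
  pushforward (mu \x (@lebesgue_measure R))%E (@swap_cons n).

Let step0 : lebesgue_step set0 = 0%E.
Proof. by rewrite /lebesgue_step /pushforward preimage_set0 measure0. Qed.

Let step_ge0 A : (0 <= lebesgue_step A)%E.
Proof. by rewrite /lebesgue_step /pushforward; exact: measure_ge0. Qed.

Let step_sigma_additive : semi_sigma_additive lebesgue_step.
Proof.
have mf := @measurable_swap_cons n.
move=> F mF tF mUF; rewrite /lebesgue_step /pushforward preimage_bigcup.
apply: measure_semi_sigma_additive.
- by move=> i; rewrite -[X in measurable X]setTI; exact: mf.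
- apply/trivIsetP => /= i j _ _ ij; rewrite -preimage_setI.
  by move/trivIsetP : tF => /(_ _ _ _ _ ij) ->//; rewrite preimage_set0.
- by rewrite -preimage_bigcup -[X in measurable X]setTI; exact: mf.
Qed.

HB.instance Definition _ := isMeasure.Build _ _ _
  lebesgue_step step0 step_ge0 step_sigma_additive.

End step.

(* Lebesgue measure on R^n, as the n-fold product of the one-dimensional one;
   the library's product sigma-algebra lives on tuples.  *)
Fixpoint lebesgue_tuple n :
    {measure set (n.-tuple (measurableTypeR R)) -> \bar R} :=
  match n with
  | 0 => \d_([tuple] : 0.-tuple (measurableTypeR R))
  | n'.+1 => lebesgue_step (lebesgue_tuple n')
  end.

Lemma lebesgue_tuple_box n (A : 'I_n -> set (measurableTypeR R)) :
  (forall i, measurable (A i)) ->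
  lebesgue_tuple n [set y | forall i, A i (tnth y i)] =
  (\prod_(i < n) lebesgue_measure (A i))%E.
Proof.
elim: n A => [|n ih] A mA.
  by rewrite big_ord0 /= diracE mem_set// => -[].
rewrite big_ord_recl /= /lebesgue_step /pushforward.
rewrite (_ : _ @^-1` _ =
  [set y | forall i, A (lift ord0 i) (tnth y i)] `*` A ord0); last first.
  apply/seteqP; split=> [[y x] /= h|[y x] /= [h h0] i].
    by split=> [i|]; [have := h (lift ord0 i); rewrite tnthS|exact: (h ord0)].
  by case: (unliftP ord0 i) => [j|] ->; [rewrite tnthS|].
have mB : measurable [set y : n.-tuple (measurableTypeR R) |
    forall i, A (lift ord0 i) (tnth y i)].
  rewrite (_ : mkset _ = \bigcap_(i in [set: 'I_n])
      ((fun y => tnth y i) @^-1` A (lift ord0 i))).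
    apply: fin_bigcap_measurable => // i _.
    by rewrite -[X in measurable X]setTI; exact: measurable_tnth.
  by apply/seteqP; split=> y /= h i; [move=> _; exact: h|exact: h].
rewrite (@product_measure1E _ _ _ _ _ (lebesgue_tuple n) lebesgue_measure)//.
by rewrite (ih (fun i => A (lift ord0 i)))// muleC.
Qed.

Definition row_of_tuple n (y : n.-tuple R) : 'rV[R]_n := \row_i tnth y i.

(* Integral over [D] of [f] with respect to n-dimensional Lebesgue measure. *)
Definition integral_Rn n (D : set 'rV[R]_n) (f : 'rV[R]_n -> R) : R :=
  \int[lebesgue_tuple n]_(y in row_of_tuple (n := n) @^-1` D)
     f (row_of_tuple y).

End LebesgueRn.

Section Calculus.
Context {R : realType} {n : nat}.
Implicit Types (f : 'rV[R]_n -> R) (v w x z : 'rV[R]_n) (U Omega : set 'rV[R]_n).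

Definition dot v w : R := \sum_i v ord0 i * w ord0 i.

(* The library norm on ['rV[R]_n] is the sup norm. *)
Definition euclidean_norm v : R := Num.sqrt (dot v v).

Definition basis_vec (i : 'I_n) : 'rV[R]_n := delta_mx ord0 i.

Definition partial (i : 'I_n) f x : R := 'D_(basis_vec i) f x.

Definition gradient f x : 'rV[R]_n := \row_i partial i f x.

Definition laplacian f x : R := \sum_i partial i (partial i f) x.

Fixpoint Ck (k : nat) U f : Prop :=
  {within U, continuous f} /\
  match k with
  | 0 => True
  | k'.+1 => forall i, (forall x, U x -> derivable f x (basis_vec i)) /\
                       Ck k' U (partial i f)
  end.

Definition boundary Omega : set 'rV[R]_n := closure Omega `\` interior Omega.

Definition bounded_domain Omega : Prop :=
  [/\ Omega !=set0, open Omega, connected Omega & bounded_set Omega].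

(* [rho] is a smooth local defining function of [Omega] near [z]:
   negative inside, zero on the boundary, with nonzero gradient there. *)
Record local_defining_function Omega z U (rho : 'rV[R]_n -> R) : Prop := {
  ldf_open : open U;
  ldf_mem : U z;
  ldf_smooth : forall k, Ck k U rho;
  ldf_inside : forall x, U x -> (Omega x <-> rho x < 0);
  ldf_boundary : forall x, U x -> (boundary Omega x <-> rho x = 0);
  ldf_regular : forall x, U x -> boundary Omega x -> gradient rho x != 0
}.

Definition smooth_boundary Omega : Prop :=
  forall z, boundary Omega z ->
    exists U rho, local_defining_function Omega z U rho.

Definition unit_outward_normal_at Omega z v : Prop :=
  exists U rho, local_defining_function Omega z U rho /\
    v = (euclidean_norm (gradient rho z))^-1 *: gradient rho z.

Definition unit_outward_normal Omega (nu : 'rV[R]_n -> 'rV[R]_n) : Prop :=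
  forall z, boundary Omega z -> unit_outward_normal_at Omega z (nu z).

(* [f] is in C^1(closure Omega): its gradient on [Omega] extends continuously,
   as [g], to the closure.  Boundary derivatives are read off from [g]. *)
Definition C1_closure Omega f (g : 'rV[R]_n -> 'rV[R]_n) : Prop :=
  [/\ {within closure Omega, continuous f},
      forall x i, Omega x -> derivable f x (basis_vec i),
      forall x, Omega x -> gradient f x = g x
    & {within closure Omega, continuous g}].

End Calculus.

Section Parabolic.
Context {R : realType} {n : nat}.
Implicit Types (Omega : set 'rV[R]_n) (T : R) (u : 'rV[R]_n -> R -> R).

Definition QT Omega T : set ('rV[R]_n * R) :=
  [set z | Omega z.1 /\ 0 < z.2 < T].

Definition ST Omega T : set ('rV[R]_n * R) :=
  [set z | boundary Omega z.1 /\ 0 < z.2 < T].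

Definition GammaT Omega T : set ('rV[R]_n * R) :=
  ST Omega T `|` [set z | closure Omega z.1 /\ z.2 = 0].

Definition C21 Omega T u : Prop :=
  [/\ {within QT Omega T, continuous (fun z => u z.1 z.2)},
      (forall x t, QT Omega T (x, t) -> derivable (u x) t 1) /\
      {within QT Omega T, continuous (fun z => derive1 (u z.1) z.2)},
      forall i,
        (forall x t, QT Omega T (x, t) ->
           derivable (u ^~ t) x (basis_vec i)) /\
        {within QT Omega T, continuous (fun z => partial i (u ^~ z.2) z.1)}
    & forall i j,
        (forall x t, QT Omega T (x, t) ->
           derivable (partial i (u ^~ t)) x (basis_vec j)) /\
        {within QT Omega T,
           continuous (fun z => partial j (partial i (u ^~ z.2)) z.1)}].

(* [u] is in C^{1,0}(Q_T \cup Gamma_T), where Q_T \cup Gamma_T is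
   closure(Omega) x [0, T); [g] is the spatial gradient, extended continuously
   up to the lateral boundary. *)
Definition C10 Omega T u (g : 'rV[R]_n -> R -> 'rV[R]_n) : Prop :=
  [/\ {within QT Omega T `|` GammaT Omega T,
         continuous (fun z => u z.1 z.2)},
      forall x t i, Omega x -> 0 <= t < T ->
        derivable (u ^~ t) x (basis_vec i),
      forall x t, Omega x -> 0 <= t < T -> gradient (u ^~ t) x = g x t
    & {within QT Omega T `|` GammaT Omega T,
         continuous (fun z => g z.1 z.2)}].

Definition admissible_kernel Omega (k : 'rV[R]_n -> 'rV[R]_n -> R -> R) : Prop :=
  let D := [set z : 'rV[R]_n * 'rV[R]_n * R |
    [/\ boundary Omega z.1.1, closure Omega z.1.2 & 0 <= z.2]] in
  {within D, continuous (fun z => k z.1.1 z.1.2 z.2)} /\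
  (forall x y t, D (x, y, t) -> 0 <= k x y t).

Definition admissible_initial_datum Omega (nu : 'rV[R]_n -> 'rV[R]_n) (l : R)
    (k : 'rV[R]_n -> 'rV[R]_n -> R -> R) (u0 : 'rV[R]_n -> R) : Prop :=
  (forall x, Omega x -> 0 <= u0 x) /\
  exists g0, C1_closure Omega u0 g0 /\
    forall x, boundary Omega x ->
      dot (g0 x) (nu x) = integral_Rn Omega (fun y => k x y 0 * u0 y `^ l).

(* [powR] satisfies 0 `^ 0 = 1, so [p = 0] reads u^p as 1. *)
Definition solution Omega (nu : 'rV[R]_n -> 'rV[R]_n) (p q m l a b : R)
    (k : 'rV[R]_n -> 'rV[R]_n -> R -> R) (u0 : 'rV[R]_n -> R) T u : Prop :=
  [/\ forall x t, (QT Omega T `|` GammaT Omega T) (x, t) -> 0 <= u x t,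
      C21 Omega T u,
      forall x t, QT Omega T (x, t) ->
        derive1 (u x) t = laplacian (u ^~ t) x
          + a * u x t `^ p * \int[lebesgue_measure]_(tau in `[0, t]) (u x tau `^ q)
          - b * u x t `^ m,
      exists g, C10 Omega T u g /\
        forall x t, ST Omega T (x, t) ->
          dot (g x t) (nu x) = integral_Rn Omega (fun y => k x y t * u y t `^ l)
    & forall x, Omega x -> u x 0 = u0 x].

End Parabolic.

(* Main.v *)
(** The solution satisfies u_t - Delta u + C u >= 0 wherever it matters: for
    m >= 1 on every Omega x ]0, t], since u is bounded there and b u^m <= C u; for
    p < m < 1, with C = 0, near a first zero (x0, t0) of u, because the memory
    integral is there bounded below by some c > 0 and a c u^p >= b u^m for small u.
    Two barriers then suffice.  A bump moving along a space-time segment carries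
    positivity from (x0, t0) to (x1, t1) with t1 > t0, hence over Omega by
    connectedness.  At a boundary point where u vanishes, a barrier built on the
    defining function rho gives the Hopf inequality du/dnu < 0, against
    du/dnu = int k u^l >= 0.  Only derivatives along the coordinate axes are
    estimated: (d_i u)(d_i rho) < 0 whenever d_i rho <> 0, and summing over i
    gives the sign of the normal derivative without any chain rule. *)
Require Import Defs.
From mathcomp Require Import all_boot all_order all_algebra.
From mathcomp Require Import all_classical all_reals all_analysis.
From mathcomp Require Import measurable_realfun.
From mathcomp Require Import ring lra.
Set Implicit Arguments.
Unset Strict Implicit.
Unset Printing Implicit Defensive.
Import Order.TTheory GRing.Theory Num.Theory.
Import numFieldNormedType.Exports.
Local Open Scope classical_set_scope.
Local Open Scope ring_scope.

(** * One-variable derivative tests at a minimum *)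

Lemma is_derive_cvg (R : realType) (F : R -> R) (x d : R) :
  is_derive x 1 F d ->
  h^-1 * (F (x + h) - F x) @[h --> 0^'] --> d.
Proof.
move=> [dF dE].
rewrite -dE; move: dF; rewrite /derivable /derive.
set G := (fun h => _ *: _); set H := (fun h => _ * _).
have -> : H = G; last by [].
by apply/funext => h; rewrite /G /H /= -[h *: 1]/(h * 1) mulr1 [h + x]addrC.
Qed.

(** Difference quotients with negative increments are nonpositive here. The minimum is one-sided
    because in [comparison] only earlier times are known to stay in the compact set. *)
Lemma left_min_derive_le0 (R : realType) (F : R -> R) (x d : R) :
  is_derive x 1 F d -> (\forall s \near x, s <= x -> F x <= F s) -> d <= 0.
Proof.
move=> dF Fm; rewrite leNgt; apply/negP => d0.
have cF := is_derive_cvg dF.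
have H : \forall h \near 0^', 0 < h^-1 * (F (x + h) - F x).
  exact: cvgr_gt cF _ d0.
have Hm : \forall h \near 0^', h <= 0 -> F x <= F (x + h).
  apply: nbhs_dnbhs; move/nbhs0P : Fm; apply: filterS => h H1 h0.
  by apply: H1; lra.
have [e /= e0 He] := filterI H Hm.
have [] := He (- (e / 2)).
- by rewrite /ball_/= sub0r opprK gtr0_norm; lra.
- by apply/eqP; lra.
move=> H1 H2.
have H3 : F x <= F (x + - (e / 2)) by apply: H2; lra.
move: H1; rewrite invrN mulNr oppr_gt0 pmulr_rlt0 ?invr_gt0 ?divr_gt0//; lra.
Qed.

(** At the minimum [d1] vanishes; if [d2 < 0], then [d1] is negative just to the right of [0], and
    the mean value theorem gives [F s < F 0] for some small [s > 0]. *)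
Lemma second_derivative_test (R : realType) (F d1 : R -> R) (d2 : R) :
  (\forall s \near (0 : R), is_derive (s : R) 1 F (d1 s)) ->
  is_derive (0 : R) 1 d1 d2 -> (\forall s \near (0 : R), F 0 <= F s) -> 0 <= d2.
Proof.
move=> dF dd Fm; rewrite leNgt; apply/negP => d20.
have cF := is_derive_cvg dd.
have H : \forall h \near 0^', h^-1 * (d1 (0 + h) - d1 0) < 0.
  exact: cvgr_lt cF _ d20.
have [e /= e0 He] : \forall h \near (0 : R),
  is_derive (h : R) 1 F (d1 h) /\ F 0 <= F h.
  exact: filterI.
have de s : `|s| < e -> is_derive (s : R) 1 F (d1 s) /\ F 0 <= F s.
  by move=> se; apply: He; rewrite /ball_/= sub0r normrN.
have d10 : d1 0 = 0.
  have [||||_ D0] := @derive1_at_min R F (- e) e 0.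
  - lra.
  - by move=> t; rewrite in_itv/= -ltr_norml => /de [[]].
  - by rewrite in_itv/=; apply/andP; split; lra.
  - by move=> t; rewrite in_itv/= -ltr_norml => /de [].
  by have [|[_ <-]//] := de 0; rewrite normr0.
have [e' /= e'0 He'] := H.
pose s := Num.min e e' / 2.
have s0 : 0 < s by rewrite divr_gt0 // lt_min e0.
have se : s < e by rewrite /s; case: (leP e e') => ?; lra.
have se' : s < e' by rewrite /s; case: (leP e e') => ?; lra.
have [|||c] := @MVT R F d1 0 s => //.
- move=> c; rewrite in_itv/= => /andP[? ?]; have [|//] := de c;
    rewrite ltr_norml; apply/andP; split; lra.
- apply: derivable_within_continuous => c; rewrite in_itv/= => /andP[? ?].
  have [|[]//] := de c; by rewrite ltr_norml; apply/andP; split; lra.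
rewrite in_itv/= => /andP[c0 cs] E.
have : c^-1 * (d1 (0 + c) - d1 0) < 0.
  apply: He'; last by rewrite gt_eqF.
  by rewrite /ball_/= sub0r normrN gtr0_norm; lra.
rewrite d10 add0r subr0 pmulr_rlt0 ?invr_gt0// => dc.
have : F 0 <= F s by have [|//] := de s; rewrite gtr0_norm.
have : d1 c * (s - 0) < 0 by rewrite nmulr_rlt0; lra.
lra.
Qed.

(** * Restriction to lines and the comparison principle *)

Lemma is_derive_line (R : realType) n (f : 'rV[R]_n -> R) (x v : 'rV[R]_n) (s : R) :
  derivable f (x + s *: v) v ->
  is_derive s 1 (fun h => f (x + h *: v)) ('D_v f (x + s *: v)).
Proof.
move=> df.
have E : (fun h : R => h^-1 *: (((fun h =>
  f (x + h *: v)) \o shift s) (h *: (1:R)) - f (x + s *: v)))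
  = (fun h : R => h^-1 *: ((f \o shift (x + s *: v)) (h *: v) - f (x + s *: v))).
  apply/funext => h /=; congr (_ *: (f _ - _)).
  rewrite scalerDl addrCA addrC -[h *: 1]/(h * 1) mulr1 [RHS]addrC -addrA
    [RHS]addrCA.
  by rewrite addrA [RHS]addrA [s *: v + x]addrC.
split; first by rewrite /derivable E.
by rewrite /derive E.
Qed.

Lemma line_cvg (R : realType) n (x v : 'rV[R]_n) :
  x + s *: v @[s --> (0 : R)] --> x.
Proof.
have : x + s *: v @[s --> (0 : R)] --> x + (0 : R) *: v.
  by apply: cvgD; [exact: cvg_cst|apply: cvgZr_tmp; exact: cvg_id].
by rewrite scale0r addr0.
Qed.

(** A filter living on this set clusters at a point of [B]; were [f] negative there, it would be
    negative on a relative neighbourhood, which the filter meets. Continuity relative to [B] is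
    enough for this. *)
Lemma compact_superlevel (R : realType) (T : topologicalType) (B : set T)
    (f : T -> R) :
  compact B -> {within B, continuous f} -> compact (B `&` [set p | 0 <= f p]).
Proof.
move=> cB /subspace_continuousP cf F FF FBf.
have FB : F B by apply: filterS FBf => p [].
have [p [Bp clp]] := cB F FF FB.
exists p; split => //; split => //=; rewrite leNgt; apply/negP => fp0.
have : \forall q \near within B (nbhs p), f q < 0 by apply: cvgr_lt (cf p Bp) _ fp0.
rewrite near_withinE => N.
have [q [[Bq /= fq0] Nq]] := clp _ _ FBf N.
by have := Nq Bq; rewrite ltNge fq0.
Qed.

(** Second-order data along the coordinate axes only: the sum of the [d2 i] stands for the
    Laplacian, and every axis is treated by one-variable calculus. *)
Definition axis_jet2 (R : realType) n (f : 'rV[R]_n -> R) (x : 'rV[R]_n)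
    (d1 : 'I_n -> R -> R) (d2 : 'I_n -> R) :=
  forall i, (\forall s \near (0 : R),
      is_derive (s : R) 1 (fun h => f (x + h *: basis_vec i)) (d1 i s)) /\
    is_derive (0 : R) 1 (d1 i) (d2 i).

(** At a negative minimum of [u - w] over [K], the difference has nonpositive time derivative,
    nonnegative second derivatives along the axes, and [C * (u - w) <= 0], against the strict
    inequality. No parabolic boundary is named: each application must show that points with [u < w]
    stay away from it. *)
Lemma comparison (R : realType) n (K : set ('rV[R]_n * R))
    (u w : 'rV[R]_n -> R -> R) (C : R) :
  compact K -> 0 <= C ->
  {within K, continuous (fun z => u z.1 z.2)} ->
  {within K, continuous (fun z => w z.1 z.2)} ->
  (forall x t, K (x, t) -> u x t < w x t ->
    [/\ forall i, \forall s \near (0 : R), K (x + s *: basis_vec i, t),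
        \forall s \near t, s <= t -> K (x, s)
      & exists ut u1 u2 wt w1 w2,
        [/\ is_derive t 1 (u x) ut, is_derive t 1 (w x) wt,
            axis_jet2 (u ^~ t) x u1 u2, axis_jet2 (w ^~ t) x w1 w2
          & wt - \sum_i w2 i + C * w x t < ut - \sum_i u2 i + C * u x t]]) ->
  forall x t, K (x, t) -> w x t <= u x t.
Proof.
move=> cK C0 cu cw H x t Kxt; rewrite leNgt; apply/negP => uw.
pose v z := u z.1 z.2 - w z.1 z.2.
have cv : {within K, continuous v}.
  by move=> z; apply: continuousB; [exact: cu|exact: cw].
have [|[y s] /set_mem Kys ymin] := @compact_EVT_min _ R v K _ cK cv.
  by exists (x, t).
have vmin z : K z -> v (y, s) <= v z by move=> Kz; apply: ymin; rewrite inE.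
have uwy : u y s < w y s.
  by have := vmin _ Kxt; rewrite /v /= -subr_lt0 => /le_lt_trans; apply; lra.
have [Kx Kt [ut [u1 [u2 [wt [w1 [w2 [dut dwt ju jw L]]]]]]]] := H _ _ Kys uwy.
have dt : ut - wt <= 0.
  apply: (@left_min_derive_le0 _ (u y - w y) s).
  by apply: filterS Kt => r Kr rs; exact: vmin (Kr rs).
have dx i : 0 <= u2 i - w2 i.
  have [n1 D1] := ju i; have [n2 D2] := jw i.
  pose F (f : 'rV[R]_n -> R -> R) h := f (y + h *: basis_vec i) s.
  apply: (@second_derivative_test _ (F u - F w) (u1 i - w1 i)).
  - near=> h; apply: is_deriveB; first by near: h; exact: n1.
    by near: h; exact: n2.
  - apply: filterS (Kx i) => h Kh; rewrite /F/= !fctE scale0r addr0.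
    exact: vmin Kh.
have : 0 <= \sum_i (u2 i - w2 i) by apply: sumr_ge0 => i _; exact: dx.
rewrite sumrB => S.
have : C * u y s <= C * w y s by apply: ler_wpM2l => //; exact: ltW.
lra.
Unshelve. all: end_near. Qed.

Lemma open_line_near (R : realType) n (O : set 'rV[R]_n) x v :
  open O -> O x -> \forall s \near (0 : R), O (x + s *: v).
Proof. by move=> oO Ox; apply: (@line_cvg _ _ x v); exact: open_nbhs_nbhs. Qed.

Lemma axis_jet2_partial (R : realType) n (O : set 'rV[R]_n) f x :
  open O -> O x ->
  (forall i y, O y -> derivable f y (basis_vec i)) ->
  (forall i y, O y -> derivable (partial i f) y (basis_vec i)) ->
  axis_jet2 f x (fun i s => partial i f (x + s *: basis_vec i))
    (fun i => partial i (partial i f) x).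
Proof.
move=> oO Ox d1 d2 i; split.
  apply: filterS (open_line_near (basis_vec i) oO Ox) => s Os.
  exact: is_derive_line (d1 _ _ Os).
rewrite -[X in partial i _ X]addr0 -[X in partial i _ (_ + X)](scale0r (basis_vec
  i)).
by apply: is_derive_line; rewrite scale0r addr0; exact: d2.
Qed.

(** * Derivatives of the barrier profiles; sup norm against dot product *)

Lemma is_derive_mul (R : realType) (f g : R -> R) (s df dg : R) :
  is_derive s 1 f df -> is_derive s 1 g dg ->
  is_derive s 1 (fun r => f r * g r) (df * g s + f s * dg).
Proof.
move=> Df Dg; apply: (is_derive_eq (is_deriveM Df Dg)).
by rewrite -!/(_ * _) addrC [g s *: df]mulrC.
Qed.

Lemma is_derive_quadratic (R : realType) (a b c s : R) :
  is_derive s 1 (fun r => a + b * r + c * r ^+ 2) (b + 2 * c * s).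
Proof.
have D1 : is_derive s 1 (fun r => r) (1 : R) by exact: is_derive_id.
have Dc (k : R) : is_derive s 1 (fun=> k) (0 : R) by exact: is_derive_cst.
have Dm (k : R) := is_derive_mul (Dc k) D1.
have D2 := is_derive_mul (Dc c) (is_derive_mul D1 D1).
apply: (is_derive_eq (is_deriveD (is_deriveD (Dc a) (Dm b)) D2)).
by rewrite /=; ring.
Qed.

Lemma is_derive_scaled_square (R : realType) (k : R) (P : R -> R) (s dP : R) :
  is_derive s 1 P dP ->
  is_derive s 1 (fun r => k * P r ^+ 2) (2 * k * P s * dP).
Proof.
move=> DP.
have Dc : is_derive s 1 (fun=> k) (0 : R) by exact: is_derive_cst.
apply: (is_derive_eq (is_derive_mul Dc (is_derive_mul DP DP))).
by rewrite /=; ring.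
Qed.

Lemma is_derive_exp_comp (R : realType) (f : R -> R) (s df : R) :
  is_derive s 1 f df ->
  is_derive s 1 (fun r => expR (f r)) (expR (f s) * df).
Proof. by move=> Df; apply: (@is_derive1_comp _ expR f). Qed.

Lemma normr_rV_le (R : realType) n (v : 'rV[R]_n) (r : R) :
  0 <= r -> `|v| <= r <-> forall i, `|v ord0 i| <= r.
Proof.
move=> r0; rewrite [`|v|]/Num.Def.normr /= mx_normrE; split.
  move=> /bigmax_leP [_ H] i; exact: (H (ord0, i)).
by move=> H; apply/bigmax_leP; split => // -[j i] _ /=; rewrite ord1.
Qed.

Lemma compact_box (R : realType) n (x : 'rV[R]_n) (r a b : R) : 0 <= r ->
  compact [set z : 'rV[R]_n * R | `|z.1 - x| <= r /\ a <= z.2 <= b].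
Proof.
move=> r0.
set S := (X in compact X); have -> : S = ([set v : 'rV[R]_n | forall i,
  `[x ord0 i - r, x ord0 i + r]%classic (v ord0 i)] `*` `[a, b]%classic);
    last first.
  by apply: compact_setX; [apply: (@rV_compact _ _ (fun i =>
    `[x ord0 i - r, x ord0 i + r]%classic)) => i|]; exact: segment_compact.
apply/seteqP; rewrite /S; split => -[v t] /= [h ht]; split; rewrite ?in_itv//=.
- move=> i; have /normr_rV_le := h; move=> /(_ r0 i);
    rewrite !mxE in_itv/= ler_norml; lra.
- apply/normr_rV_le => // i; have := h i; rewrite !mxE in_itv/= ler_norml; lra.
Qed.

Lemma dot_ge0 (R : realType) n (v : 'rV[R]_n) : 0 <= dot v v.
Proof. by apply: sumr_ge0 => i _; rewrite -expr2 sqr_ge0. Qed.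

Lemma coord_sqr_le_dot (R : realType) n (v : 'rV[R]_n) i :
  v ord0 i ^+ 2 <= dot v v.
Proof.
rewrite /dot (bigD1 i)//= -expr2 lerDl.
by apply: sumr_ge0 => j _; rewrite -expr2 sqr_ge0.
Qed.

(** The sup norm is dominated by the Euclidean one, so the Euclidean regions cut out by the barriers
    fit into sup-norm boxes. *)
Lemma normr_le_of_dot (R : realType) n (v : 'rV[R]_n) (r : R) :
  0 <= r -> dot v v <= r ^+ 2 -> `|v| <= r.
Proof.
move=> r0 vr; apply/normr_rV_le => // i.
rewrite -(@ler_pXn2r _ 2)// ?nnegrE// real_normK ?num_real//.
exact: le_trans (coord_sqr_le_dot _ _) vr.
Qed.

Lemma dot_add_basis (R : realType) n (v : 'rV[R]_n) (s : R) i :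
  dot (v + s *: basis_vec i) (v + s *: basis_vec i) =
  dot v v + 2 * v ord0 i * s + s ^+ 2.
Proof.
rewrite /dot (bigD1 i)//= [in RHS](bigD1 i)//= /basis_vec !mxE !eqxx/=.
rewrite (eq_bigr (fun j => v ord0 j * v ord0 j)); first by ring.
by move=> j ji; rewrite !mxE (negbTE ji) andbF mulr0 addr0.
Qed.

Lemma dot_sub_line (R : realType) n (v d : 'rV[R]_n) (s : R) :
  dot (v - s *: d) (v - s *: d) = dot v v - 2 * s * dot v d + s ^+ 2 * dot d d.
Proof.
rewrite /dot !mulr_sumr -sumrN -!big_split /=; apply: eq_bigr => i _.
by rewrite !mxE; ring.
Qed.

Lemma dotBl (R : realType) n (v d w : 'rV[R]_n) (s : R) :
  dot (v - s *: d) w = dot v w - s * dot d w.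
Proof.
rewrite /dot !mulr_sumr -sumrN -!big_split /=; apply: eq_bigr => i _.
by rewrite !mxE; ring.
Qed.

(** A coordinatewise substitute for Cauchy-Schwarz; the factor [n] counts the coordinates. *)
Lemma normr_dot_le (R : realType) n (v w : 'rV[R]_n) (r s : R) :
  `|v| <= r -> `|w| <= s -> `|dot v w| <= n%:R * (r * s).
Proof.
move=> vr ws.
have r0 : 0 <= r by apply: le_trans vr.
have s0 : 0 <= s by apply: le_trans ws.
apply: le_trans (ler_norm_sum _ _ _) _.
rewrite -[n in n%:R]card_ord mulr_natl -sumr_const; apply: ler_sum => i _.
by rewrite normrM ler_pM// (normr_rV_le _ _).1.
Qed.

Lemma continuous_dot_comp (R : realType) n (T : topologicalType)
    (f : T -> 'rV[R]_n) :
  continuous f -> continuous (fun z => dot (f z) (f z)).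
Proof.
move=> cf z; rewrite /dot.
apply: cvg_big => [|i _]; first exact: add_continuous.
have cfi : f y ord0 i @[y --> z] --> f z ord0 i.
  by apply: (@cvg_comp _ _ _ f (fun M : 'rV[R]_n => M ord0 i) _ _ _ (cf z));
    exact: coord_continuous.
exact: cvgM.
Qed.

Lemma is_derive_affine (R : realType) (a b s : R) :
  is_derive s 1 (fun r => a + b * r) b.
Proof.
have -> : (fun r : R => a + b * r) = (fun r => a + b * r + 0 * r ^+ 2).
  by apply/funext => r; ring.
by apply: (is_derive_eq (is_derive_quadratic a b 0 s)); ring.
Qed.

(** Along a coordinate axis the barrier of [propagation] is a constant times the square of a
    quadratic polynomial. *)
Lemma jet2_scaled_square_quadratic (R : realType) (k a b c : R) :
  let P r := a + b * r + c * r ^+ 2 in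
  let D r := 2 * k * P r * (b + 2 * c * r) in
  (forall s : R, is_derive s 1 (fun r => k * P r ^+ 2) (D s)) /\
  is_derive (0 : R) 1 D (2 * k * (b ^+ 2 + 2 * a * c)).
Proof.
split; first by move=> s; apply: is_derive_scaled_square;
  exact: is_derive_quadratic.
have Dc : is_derive (0 : R) 1 (fun=> 2 * k) (0 : R) by exact: is_derive_cst.
have D1 := is_derive_mul Dc (is_derive_quadratic a b c 0).
apply: (is_derive_eq (is_derive_mul D1 (is_derive_affine b (2 * c) 0))).
by rewrite /=; ring.
Qed.

(** * Propagation of positivity inside the domain *)

Lemma within_continuous_gt (R : realType) n (D : set ('rV[R]_n * R))
    (f : 'rV[R]_n -> R -> R) x t c :
  {within D, continuous (fun z => f z.1 z.2)} -> D (x, t) -> c < f x t ->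
  exists2 e, 0 < e & forall y s, D (y, s) -> `|y - x| < e -> `|s - t| < e ->
    c < f y s.
Proof.
move=> /subspace_continuousP cf Dxt cfx.
have : \forall q \near within D (nbhs (x, t)), c < f q.1 q.2.
  by apply: cvgr_gt (cf _ Dxt) _ cfx.
rewrite near_withinE => /nbhs_ballP[e /= e0 He].
exists e => // y s Dys yx st.
apply: (He (y, s)) => //; split => /=.
  by rewrite -ball_normE /ball_/= distrC.
by rewrite -ball_normE /ball_/= distrC.
Qed.

(** A one-piece form of [QT Omega T] united with [GammaT Omega T]; see [QT_GammaT_cylinder]. *)
Definition cylinder (R : realType) n (Omega : set 'rV[R]_n) (T : R) :=
  [set z : 'rV[R]_n * R | closure Omega z.1 /\ 0 <= z.2 < T].

Definition supersolution (R : realType) n (S : set ('rV[R]_n * R)) (C : R)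
    (u : 'rV[R]_n -> R -> R) :=
  forall x t, S (x, t) ->
    0 <= derive1 (u x) t - laplacian (u ^~ t) x + C * u x t.

Lemma near_line_gt0 (R : realType) n (f : 'rV[R]_n -> R -> R) x t v :
  f z.1 z.2 @[z --> (x, t)] --> f x t -> 0 < f x t ->
  \forall s \near (0 : R), 0 < f (x + s *: v) t.
Proof.
move=> cf fx.
have cv : f (x + s *: v) t @[s --> (0 : R)] --> f x t; last exact: cvgr_gt cv _ fx.
by apply: (@continuous2_cvg _ _ _ _ _ _ (fun s : R =>
  x + s *: v) (fun=> t) f x t cf); [exact: line_cvg|exact: cvg_cst].
Qed.

Lemma near_time_gt0 (R : realType) n (f : 'rV[R]_n -> R -> R) x t :
  f z.1 z.2 @[z --> (x, t)] --> f x t -> 0 < f x t ->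
  \forall s \near t, 0 < f x s.
Proof.
move=> cf fx.
have cv : f x s @[s --> t] --> f x t; last exact: cvgr_gt cv _ fx.
by apply: (@continuous2_cvg _ _ _ _ _ _ (fun=> x) id f x t cf);
  [exact: cvg_cst|exact: cvg_id].
Qed.

Section propagation.
Context {R : realType} {n : nat} (Omega : set 'rV[R]_n) (T : R)
  (u : 'rV[R]_n -> R -> R).
Hypotheses (oOmega : open Omega) (C21u : C21 Omega T u).

Lemma C21_is_derive_t x t : Omega x -> 0 < t < T ->
  is_derive t 1 (u x) (derive1 (u x) t).
Proof.
move=> Ox tT; have [_ [dt _] _ _] := C21u.
by apply: DeriveDef; [exact: dt|rewrite derive1E].
Qed.

Lemma C21_axis_jet2 x t : Omega x -> 0 < t < T ->
  axis_jet2 (u ^~ t) x (fun i s => partial i (u ^~ t) (x + s *: basis_vec i))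
    (fun i => partial i (partial i (u ^~ t)) x).
Proof.
move=> Ox tT; have [_ _ d1 d2] := C21u.
apply: (axis_jet2_partial oOmega Ox) => i y Oy; first exact: (d1 i).1.
exact: (d2 i i).1.
Qed.

Hypothesis cu : {within cylinder Omega T, continuous (fun z => u z.1 z.2)}.
Hypothesis u_ge0 : forall x t, Omega x -> 0 <= t < T -> 0 <= u x t.

(* The barrier is supported on the tube of radius [r] around the segment from
   [(x0, t0)] to [(x1, t1)]; with [phi = r^2 - |x - xi(t)|^2] one has
   [|grad phi|^2 = 4 (r^2 - phi)], so the heat operator applied to [phi^2]
   is at most [A phi - 8 r^2], which [- beta phi^2] makes negative. *)
Lemma propagation C x0 x1 rho t0 t1 : 0 <= C -> 0 < rho ->
  (forall y, `|y - x0| <= 2 * rho -> Omega y) -> `|x1 - x0| <= rho ->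
  0 <= t0 -> t0 < t1 -> t1 < T ->
  supersolution [set z | `|z.1 - x0| <= 2 * rho /\ t0 < z.2 <= t1] C u ->
  0 < u x0 t0 -> 0 < u x1 t1.
Proof.
move=> C0 rho0 bO x1x0 t00 t01 t1T Su ux0.
have Ox0 : Omega x0 by apply: bO; rewrite subrr normr0; lra.
have OD y s : Omega y -> t0 <= s <= t1 -> cylinder Omega T (y, s).
  by move=> Oy st; split => /=; [exact: subset_closure|lra].
have [r r0 [rrho Hr]] : exists2 r, 0 < r & r <= rho /\
    forall y, `|y - x0| <= r -> 0 < u y t0.
  have [|e e0 He] := within_continuous_gt cu _ ux0; first by apply: OD => //; lra.
  exists (Num.min rho (e / 2)); first by rewrite lt_min rho0; lra.
  split; first by rewrite ge_min lexx.
  move=> y; rewrite le_min => /andP[yr ye]; apply: He.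
  - by apply: OD; [apply: bO|]; lra.
  - by lra.
  - by rewrite subrr normr0.
have [eta eta0 Heta] : exists2 eta, 0 < eta &
    forall y, `|y - x0| <= r -> eta <= u y t0.
  (* A box of zero duration: the time slice at [t0]. *)
  have cK := @compact_box R n x0 r t0 t0 (ltW r0).
  have [||[c s] /set_mem[/= cr st] mc] :=
    compact_EVT_min _ cK (_ : {within _, continuous (fun z => u z.1 z.2)}).
  - by exists (x0, t0); split => /=; rewrite ?subrr ?normr0; lra.
  - apply: continuous_subspaceW cu => -[y s] /= [yr st].
    by apply: OD; [apply: bO|]; lra.
  have st0 : s = t0 by apply/le_anti; rewrite andbC.
  rewrite st0 in mc.
  exists (u c t0); first exact: Hr.
  by move=> y yr; apply: (mc (y, t0)); rewrite inE; split => //=; lra.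
pose sg := (t1 - t0)^-1; pose d := x1 - x0.
have sg0 : 0 < sg by rewrite invr_gt0; lra.
(* Displacement from the moving centre [x0 + (sg * (t - t0)) *: d], which runs from [x0] at time
   [t0] to [x1] at time [t1]. *)
pose v (x : 'rV[R]_n) (t : R) := x - x0 - (sg * (t - t0)) *: d.
pose phi x t := r ^+ 2 - dot (v x t) (v x t).
(* [M] bounds the time derivative of [phi] on the tube. [A] collects the terms linear in [phi]:
   [2 * M] from the time derivative and [8 + 4 * n%:R] from the Laplacian of [phi ^+ 2]. The excess
   of [beta] over [C] makes the resulting quadratic in [phi] negative. *)
pose M := 2 * sg * (n%:R * (r * rho)).
pose A := 2 * M + 8 + 4 * n%:R.
pose beta := C + A ^+ 2 / (16 * r ^+ 2).
(* Since [phi <= r ^+ 2] and the exponential factor of [w] is [1] at time [t0], this scaling gives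
   [w <= eta] initially. *)
pose k := eta / r ^+ 4.
have k0 : 0 < k by rewrite divr_gt0// exprn_gt0.
pose w x t := expR (beta * t0 + - beta * t) * (k * phi x t ^+ 2).
pose B := [set z : 'rV[R]_n * R | `|z.1 - x0| <= 2 * rho /\ t0 <= z.2 <= t1].
pose K := B `&` [set z | 0 <= phi z.1 z.2].
have cphi : continuous (fun z => phi z.1 z.2).
  move=> z; apply: cvgB; first exact: cvg_cst.
  apply: (@continuous_dot_comp _ _ _ (fun z => v z.1 z.2)) => {}z.
  apply: cvgB; first by apply: cvgB; [exact: cvg_fst|exact: cvg_cst].
  apply: cvgZr_tmp; apply: cvgM; first exact: cvg_cst.
  by apply: cvgB; [exact: cvg_snd|exact: cvg_cst].
have cK : compact K.
  apply: (@compact_superlevel _ _ B (fun z => phi z.1 z.2)).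
    by apply: compact_box; lra.
  exact: continuous_subspaceT.
have vle x t : 0 <= phi x t -> `|v x t| <= r.
  by move=> p0; apply: normr_le_of_dot; [lra|rewrite -subr_ge0].
have phi_le x t : phi x t <= r ^+ 2 by rewrite gerBl dot_ge0.
(* The tube stays in the box because [r + rho <= 2 * rho]; hence [0 <= phi] alone decides membership
   in [K] at these times. *)
have phiB x t : t0 <= t <= t1 -> 0 <= phi x t -> K (x, t).
  move=> tt p0; split => //; split => //=.
  have -> : x - x0 = v x t + (sg * (t - t0)) *: d by rewrite /v subrK.
  apply: le_trans (ler_normD _ _) _.
  have := vle _ _ p0; rewrite normrZ.
  have : `|sg * (t - t0)| * `|d| <= 1 * rho.
    apply: ler_pM => //.
    rewrite ger0_norm; first by rewrite /sg mulrC ler_pdivrMr; lra.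
    by apply: mulr_ge0; lra.
  lra.
have KO x t : K (x, t) -> Omega x by move=> [[/= xx _] _]; exact: bO.
have w_le : forall x t, K (x, t) -> w x t <= u x t.
  apply: (comparison cK C0).
  - apply: continuous_subspaceW cu => -[x t] Kxt.
    by apply: OD; [exact: (KO _ _ Kxt)|case: Kxt => -[]].
  - apply: continuous_subspaceT => z; apply: cvgM.
      apply: (@cvg_comp _ _ _ (fun z : 'rV[R]_n * R =>
        beta * t0 + - beta * z.2) expR _ (nbhs (beta * t0 + - beta * z.2)));
          last exact: continuous_expR.
      apply: cvgD; first exact: cvg_cst.
      by apply: cvgM; [exact: cvg_cst|exact: cvg_snd].
    apply: cvgM; first exact: cvg_cst.
    by rewrite /GRing.exp/=; apply: cvgM; exact: cphi.
  move=> x t Kxt uw.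
  have Ox := KO _ _ Kxt.
  have [[/= xx tt] phi0] := Kxt.
  have tT : 0 <= t < T by lra.
  (* Points with [u < w] avoid the lateral side, where [w] vanishes, and then the initial slice,
     where [w <= eta <= u]. *)
  have phi_gt0 : 0 < phi x t.
    rewrite lt_neqAle phi0 andbT; apply/eqP => p0.
    have := u_ge0 Ox tT; move: uw; rewrite /w -p0 expr0n/= !mulr0; lra.
  have t0t : t0 < t.
    rewrite lt_neqAle (andP tt).1 andbT; apply/eqP => tE.
    move: uw; rewrite /w -tE mulNr subrr expR0 mul1r.
    have xr : `|x - x0| <= r.
      by have := vle _ _ phi0; rewrite /v -tE subrr mulr0 scale0r subr0.
    have := Heta _ xr; rewrite /k.
    have : eta / r ^+ 4 * phi x t0 ^+ 2 <= eta.
      rewrite -mulrA ler_piMr ?(ltW eta0)// [_^-1 * _]mulrC ler_pdivrMr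
        ?exprn_gt0// mul1r.
      have -> : r ^+ 4 = (r ^+ 2) ^+ 2 by rewrite -exprM.
      by rewrite ler_pXn2r// ?nnegrE ?sqr_ge0// tE.
    lra.
  split.
  - move=> i.
    have := near_line_gt0 (basis_vec i) (cphi (x, t)) phi_gt0.
    by apply: filterS => s ps; apply: phiB => //; exact: ltW.
  - have np := near_time_gt0 (cphi (x, t)) phi_gt0.
    near=> s => st; apply: phiB; last by apply: ltW; near: s.
    have : t0 < s by near: s; exact: lt_nbhsr.
    lra.
  have tT' : 0 < t < T by lra.
  pose E := expR (beta * t0 + - beta * t).
  have E0 : 0 < E by exact: expR_gt0.
  pose pt := 2 * sg * dot (v x t) d.
  have dphi : is_derive t 1 (phi x) pt.
    have -> : phi x = (fun s => (r ^+ 2 - dot (x - x0) (x - x0) - 2 * sg * t0 *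
      dot (x - x0) d - sg ^+ 2 * t0 ^+ 2 * dot d d)
      + (2 * sg * dot (x - x0) d + 2 * sg ^+ 2 * t0 * dot d d) * s + (- sg ^+ 2 *
        dot d d) * s ^+ 2).
      by apply/funext => s; rewrite /phi /v dot_sub_line; ring.
    by apply: (is_derive_eq (is_derive_quadratic _ _ _ _)); rewrite /pt /v dotBl;
      ring.
  pose P i s := phi x t + - 2 * v x t ord0 i * s + - 1 * s ^+ 2.
  pose wt := E * - beta * (k * phi x t ^+ 2) + E * (2 * k * phi x t * pt).
  exists (derive1 (u x) t), (fun i s => partial i (u ^~ t) (x + s *: basis_vec i)),
    (fun i => partial i (partial i (u ^~ t)) x), wt,
    (fun i s => 2 * (E * k) * P i s * (- 2 * v x t ord0 i + 2 * - 1 * s)),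
    (fun i => 2 * (E * k) * ((- 2 * v x t ord0 i) ^+ 2 + 2 * phi x t * - 1)).
  split; [exact: C21_is_derive_t| |exact: C21_axis_jet2| |].
  - apply: is_derive_mul; last exact: is_derive_scaled_square.
    by apply: is_derive_exp_comp; exact: is_derive_affine.
  - move=> i.
    have -> : (fun h => w (x + h *: basis_vec i) t) = (fun s =>
      (E * k) * P i s ^+ 2).
      apply/funext => h; rewrite /w -/E mulrA; congr (_ * _ ^+ 2).
      rewrite /P /phi (_ : v _ t = v x t + h *: basis_vec i); last first.
        by rewrite /v [RHS]addrAC; congr (_ - _); rewrite addrAC.
      by rewrite dot_add_basis; ring.
    have [J1 J2] := jet2_scaled_square_quadratic (E * k) (phi x t) (- 2 * v x t
      ord0 i) (- 1).
    by split; [near=> s; exact: J1|exact: J2].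
  apply: lt_le_trans (_ : _ < 0) _; last by apply: Su; split => /=; lra.
  have -> : \sum_i 2 * (E * k) * ((- 2 * v x t ord0 i) ^+ 2 + 2 * phi x t * - 1)
      = E * k * (8 * (r ^+ 2 - phi x t) - 4 * n%:R * phi x t).
    rewrite -mulr_sumr big_split /= sumr_const card_ord.
    have -> : \sum_(i < n) (- 2 * v x t ord0 i) ^+ 2 = 4 * dot (v x t) (v x t).
      by rewrite /dot mulr_sumr; apply: eq_bigr => i _; ring.
    by rewrite -mulr_natl /phi; ring.
  have ptM : `|pt| <= M.
    rewrite /pt /M normrM ger0_norm; last by lra.
    rewrite ler_wpM2l//; first by lra.
    by apply: normr_dot_le => //; exact: vle.
  have -> : wt - E * k * (8 * (r ^+ 2 - phi x t) - 4 * n%:R * phi x t) + C * w x t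
     = E * k * (- (beta - C) * phi x t ^+ 2 + 2 * phi x t * pt - 8 * r ^+ 2 + (8
       + 4 * n%:R) * phi x t).
    by rewrite /wt /w -/E; ring.
  rewrite pmulr_rlt0; last exact: mulr_gt0.
  have h1 : phi x t * pt <= phi x t * M.
    by rewrite ler_wpM2l//; apply: le_trans (ler_norm _) ptM.
  apply: le_lt_trans (_ : _ <= - (A ^+ 2 / (16 * r ^+ 2)) * phi x t ^+ 2 + A *
    phi x t - 8 * r ^+ 2) _.
    rewrite (_ : beta - C = A ^+ 2 / (16 * r ^+ 2)); last by rewrite /beta; ring.
    by rewrite [in X in _ <= _ + X * _ - _]/A; lra.
  (* Completing the square leaves the strictly negative remainder [- 4 * r ^+ 2]. *)
  have -> : - (A ^+ 2 / (16 * r ^+ 2)) * phi x t ^+ 2 + A * phi x t - 8 * r ^+ 2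
      = - (r ^+ 2 * ((A * phi x t / r ^+ 2 / 4 - 2) ^+ 2 + 4)).
    by field; rewrite gt_eqF.
  rewrite oppr_lt0 mulr_gt0 ?exprn_gt0//.
  by apply: ltr_wpDl => //; exact: sqr_ge0.
have v1 : v x1 t1 = 0.
  by rewrite /v -/d /sg mulVf ?scale1r ?subrr//; apply/eqP; lra.
have phi1 : phi x1 t1 = r ^+ 2.
  rewrite /phi v1 /dot big1 ?subr0// => i _; by rewrite mxE mul0r.
apply: lt_le_trans (w_le x1 t1 _).
  by rewrite mulr_gt0 ?expR_gt0// mulr_gt0// phi1 !exprn_gt0.
by apply: phiB; [lra|rewrite phi1 exprn_ge0// ltW].
Unshelve. all: end_near. Qed.
End propagation.

(** * The Hopf inequality at a boundary zero *)

Lemma cvg_near_le (R : realType) (T : topologicalType) (f : T -> R) x e :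
  f y @[y --> x] --> f x -> 0 < e -> \forall y \near x, `|f y - f x| <= e.
Proof.
move=> cf e0; have /cvgrPdist_le/(_ e e0) := cf.
by apply: filterS => y; rewrite distrC.
Qed.

Lemma normr_basis_vec (R : realType) n (i : 'I_n) :
  `|basis_vec i : 'rV[R]_n| = 1.
Proof.
apply/le_anti/andP; split.
  apply/normr_rV_le => // j; rewrite !mxE eqxx /=.
  by case: (j == i); rewrite ?normr1 ?normr0.
have := (normr_rV_le (basis_vec i : 'rV[R]_n) (normr_ge0 _)).1 (lexx _) i.
by rewrite !mxE !eqxx normr1.
Qed.

Lemma continuous_pair (S T U : topologicalType) (f : S -> T) (g : S -> U) :
  continuous f -> continuous g -> continuous (fun s => (f s, g s)).
Proof. by move=> cf cg s; exact: (cvg_pair (cf s) (cg s)). Qed.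

Lemma continuous_within_comp (R : realType) (S T : topologicalType) (A : set S)
    (D : set T) (h : S -> T) (F : T -> R) :
  {within D, continuous F} -> continuous h -> (forall s, A s -> D (h s)) ->
  {within A, continuous (F \o h)}.
Proof.
move=> /subspace_continuousP cF ch AD; apply/subspace_continuousP => s As.
apply: cvg_comp (cF _ (AD _ As)) => N /= DN.
change (nbhs s (fun r => A r -> N (h r))).
have : nbhs s (fun r => D (h r) -> N (h r)) by exact: (ch s _ DN).
by apply: filterS => r DNr Ar; apply: DNr; exact: AD.
Qed.

Lemma is_derive_scaled_expR (R : realType) (k al : R) (P : R -> R) (s dP : R) :
  is_derive s 1 P dP ->
  is_derive s 1 (fun r => k * (expR (al * P r) - 1))
    (k * al * expR (al * P s) * dP).
Proof.
move=> dPs.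
have Dc (c : R) : is_derive s 1 (fun=> c) (0 : R) by exact: is_derive_cst.
have dal : is_derive s 1 (fun r => al * P r) (al * dP).
  by apply: (is_derive_eq (is_derive_mul (Dc al) dPs)); ring.
have De := is_derive_exp_comp dal.
apply: (is_derive_eq (is_derive_mul (Dc k) (is_deriveB De (Dc 1)))).
by ring.
Qed.

Lemma is_derive2_scaled_expR (R : realType) (k al : R) (P D : R -> R) (s d2 : R) :
  is_derive s 1 P (D s) -> is_derive s 1 D d2 ->
  is_derive s 1 (fun r => k * al * expR (al * P r) * D r)
    (k * al * expR (al * P s) * (al * D s ^+ 2 + d2)).
Proof.
move=> dPs dDs.
have Dc (c : R) : is_derive s 1 (fun=> c) (0 : R) by exact: is_derive_cst.
have dal : is_derive s 1 (fun r => al * P r) (al * D s).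
  by apply: (is_derive_eq (is_derive_mul (Dc al) dPs)); ring.
have De := is_derive_exp_comp dal.
apply: (is_derive_eq (is_derive_mul (is_derive_mul (Dc (k * al)) De) dDs)).
by ring.
Qed.

Lemma open_within_continuous (R : realType) (T : topologicalType) (U : set T)
    (f : T -> R) x :
  open U -> {within U, continuous f} -> U x -> f y @[y --> x] --> f x.
Proof. by move=> oU; rewrite continuous_open_subspace// => cf Ux; apply: cf;
  rewrite inE. Qed.

Lemma is_derive_scaled_line (R : realType) n (f : 'rV[R]_n -> R)
    (x v : 'rV[R]_n) (c s : R) :
  derivable f (x + (c * s) *: v) v ->
  is_derive s 1 (fun h => f (x + (c * h) *: v)) ('D_v f (x + (c * s) *: v) * c).
Proof.
move=> df; have dc : is_derive s 1 (fun h => c * h) c.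
  have -> : (fun h : R => c * h) = (fun h => 0 + c * h) by apply/funext => r;
    rewrite add0r.
  exact: is_derive_affine.
apply: (@is_derive1_comp _ (fun h => f (x + h *: v)) (fun h => c * h)) => //.
exact: is_derive_line.
Qed.

Section hopf.
Context {R : realType} {n : nat} (Omega : set 'rV[R]_n) (T : R)
  (u : 'rV[R]_n -> R -> R).
Hypotheses (oOmega : open Omega) (C21u : C21 Omega T u).
Hypothesis cu : {within cylinder Omega T, continuous (fun z => u z.1 z.2)}.
Variable g : 'rV[R]_n -> R -> 'rV[R]_n.
Hypothesis gu : forall x t, Omega x -> 0 <= t < T -> gradient (u ^~ t) x = g x t.
Hypothesis cg : {within cylinder Omega T, continuous (fun z => g z.1 z.2)}.

(** Boundary derivatives exist only through the continuous extension [g]. If the claim failed,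
    continuity of [g] would keep the inward derivative below [kappa] near [z], while the mean value
    theorem on a short segment from [z] produces a point where it is at least [kappa]. *)
Lemma inward_derivative_ge z t0 i sg kappa d :
  closure Omega z -> 0 < t0 < T -> u z t0 = 0 -> 0 < d ->
  (forall s, 0 < s < d -> Omega (z + (sg * s) *: basis_vec i) /\
     kappa * s <= u (z + (sg * s) *: basis_vec i) t0) ->
  kappa <= sg * g z t0 ord0 i.
Proof.
move=> Oz tT uz d0 H; rewrite leNgt; apply/negP => gk.
pose X (s : R) := z + (sg * s) *: basis_vec i.
have Xcyl s : 0 <= s < d -> cylinder Omega T (X s, t0).
  move=> sd; split => /=; last by lra.
  have [s0|s0] := eqVneq s 0; first by rewrite /X s0 mulr0 scale0r addr0.
  by apply: subset_closure; apply: (H s _).1; lra.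
have cX : continuous X.
  move=> s; apply: cvgD; first exact: cvg_cst.
  by apply: cvgZr_tmp; apply: cvgM; [exact: cvg_cst|exact: cvg_id].
have cgi : {within cylinder Omega T, continuous (fun z =>
  - (sg * g z.1 z.2 ord0 i))}.
  apply/subspace_continuousP => p Dp.
  apply: cvgN; apply: cvgM; first exact: cvg_cst.
  have /subspace_continuousP/(_ _ Dp) cgp := cg.
  by apply: (@cvg_comp _ _ _ _ (fun M : 'rV[R]_n => M ord0 i) _ _ _ cgp);
    exact: coord_continuous.
have [||e e0 He] := @within_continuous_gt _ _ _ (fun x t =>
  - (sg * g x t ord0 i)) z t0 (- kappa) cgi.
- by have := Xcyl 0; rewrite /X mulr0 scale0r addr0; apply; lra.
- lra.
have [s s0 [sd se]] : exists2 s, 0 < s & s < d /\ `|sg| * s < e.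
  exists (Num.min (d / 2) (e / 2 / (`|sg| + 1))).
    by rewrite lt_min !divr_gt0// ltr_wpDl.
  split; first by rewrite gt_min; apply/orP; left; lra.
  apply: le_lt_trans (_ : _ <= `|sg| * (e / 2 / (`|sg| + 1))) _.
    by rewrite ler_wpM2l// ge_min lexx orbT.
  apply: le_lt_trans (_ : _ <= e / 2) _; last lra.
  have s1 : 0 < `|sg| + 1 by rewrite ltr_wpDl.
  rewrite mulrA ler_pdivrMr// mulrC ler_wpM2l; lra.
have [||c] := @MVT R (fun s => u (X s) t0) (fun s =>
  partial i (u ^~ t0) (X s) * sg) 0 s s0.
- move=> c; rewrite in_itv/= => cs.
  have [|Oc _] := H c; first by lra.
  have [_ _ d1 _] := C21u.
  by apply: is_derive_scaled_line; exact: (d1 i).1.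
- apply: (@continuous_within_comp _ _ _ _ _ (fun s => (X s, t0)) _ cu).
    by apply: continuous_pair => // r; exact: cvg_cst.
  by move=> r; rewrite /= in_itv/= => rs; apply: Xcyl; lra.
rewrite in_itv/= => cs.
have [|Oc _] := H c; first lra.
have [|_ us] := H s; first lra.
have := He (X c) t0; rewrite subrr normr0 => /(_ _ _ e0).
have -> : `|X c - z| < e.
  rewrite /X addrC addKr normrZ normrM.
  have -> : `|basis_vec i : 'rV[R]_n| = 1 by exact: normr_basis_vec.
  rewrite mulr1 (gtr0_norm (_ : 0 < c)); last lra.
  apply: le_lt_trans se; rewrite ler_wpM2l//; lra.
move=> /(_ _ isT) -/(_ _) h.
have : - kappa < - (sg * g (X c) t0 ord0 i) by apply: h; apply: Xcyl; lra.
have -> : g (X c) t0 ord0 i = partial i (u ^~ t0) (X c).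
  by rewrite -gu ?mxE//; lra.
have -> : X 0 = z by rewrite /X mulr0 scale0r addr0.
rewrite uz !subr0 => gt E; move: us; rewrite -/(X s) E.
by rewrite ler_pM2r//; lra.
Qed.

Hypothesis u_ge0 : forall x t, Omega x -> 0 <= t < T -> 0 <= u x t.

(* The barrier is [expR (al * psi) - 1] with
   [psi = - rho - |x - z|^2 - (t0 - t)].  On [psi >= 0] one has [rho < 0] except
   at [(z, t0)], so that set touches the boundary of [Omega] only there and no
   interior sphere is needed; [d_i rho z != 0] keeps [grad psi] away from zero
   near [z], and a large [al] makes the barrier a strict subsolution. *)
Lemma hopf C z U rho t0 e0 i :
  local_defining_function Omega z U rho -> boundary Omega z -> 0 < t0 < T ->
  0 <= C -> u z t0 = 0 -> 0 < e0 ->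
  let N := [set p | [/\ Omega p.1, `|p.1 - z| <= e0 & t0 - e0 <= p.2 <= t0]] in
  (forall x t, N (x, t) -> 0 < u x t) -> supersolution N C u ->
  partial i rho z != 0 -> g z t0 ord0 i * partial i rho z < 0.
Proof.
move=> [oU Uz smooth ins bd _] bz tT C0 uz e00 N uN sN gi0.
have rhoz : rho z = 0 by apply/bd.
have [crho d1rho] := smooth 2.
pose gam := `|partial i rho z|.
have gam0 : 0 < gam by rewrite normr_gt0.
have cr y : U y -> rho x @[x --> y] --> rho y by exact: open_within_continuous.
(* The two bounds by [gam / 4] keep the [i]-th component of the gradient of [psi] at least [gam / 2]
   in absolute value on the box; [r < t0] keeps its times positive. *)
have [r r0 [re0 rt0 rgam rN]] : exists2 r, 0 < r &
  [/\ r <= e0, r < t0, 2 * r <= gam / 4 & forall x, `|x - z| <= r ->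
    [/\ U x, `|rho x| <= 1, `|partial i rho x - partial i rho z| <= gam / 4
      & forall j, `|partial j (partial j rho) x|
        <= `|partial j (partial j rho) z| + 1]].
  have n1 : \forall x \near z, U x by exact: open_nbhs_nbhs.
  have n2 : \forall x \near z, `|rho x| <= 1.
    have := cvg_near_le (cr z Uz) ltr01; rewrite rhoz.
    by apply: filterS => x; rewrite subr0.
  have n3 : \forall x \near z, `|partial i rho x - partial i rho z| <= gam / 4.
    have [_ [c1 _]] := d1rho i.
    have g4 : 0 < gam / 4 by lra.
    exact: cvg_near_le (open_within_continuous oU c1 Uz) g4.
  have n4 : \forall x \near z, forall j,
      `|partial j (partial j rho) x| <= `|partial j (partial j rho) z| + 1.
    apply: (@filter_forall _ _ (fun j x =>
      `|partial j (partial j rho) x| <= `|partial j (partial j rho) z| + 1)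
        (nbhs z)) => j.
    have [_ [_ /(_ j)[_ [c2 _]]]] := d1rho j.
    have := cvg_near_le (open_within_continuous oU c2 Uz) ltr01.
    by apply: filterS => x h; rewrite -lerBlDl; apply: le_trans h; exact: lerB_dist.
  have [e /= e1 He] : nbhs_ball z (fun x =>
    [/\ U x, `|rho x| <= 1, `|partial i rho x - partial i rho z| <= gam / 4
      & forall j, `|partial j (partial j rho) x|
        <= `|partial j (partial j rho) z| + 1]).
    by apply/nbhs_ballP; near=> x; split; near: x.
  exists (Num.min (Num.min e0 (t0 / 2)) (Num.min (gam / 8) (e / 2))).
    by rewrite !lt_min e00; lra.
  split.
  - by rewrite !ge_min lexx.
  - by rewrite !gt_min; apply/orP; left; apply/orP; right; lra.
  - rewrite mulrC -ler_pdivlMr//; apply: le_trans (_ : _ <= gam / 8) _; last lra.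
    by rewrite !ge_min lexx !orbT.
  - move=> x; rewrite !le_min => /andP[_ /andP[_ xe]]; apply: He.
    by rewrite -ball_normE /ball_/= distrC; lra.
have cz : closure Omega z by case: bz.
pose psi x t := - rho x - dot (x - z) (x - z) - (t0 - t).
pose m2 := \sum_j (`|partial j (partial j rho) z| + 1).
(* Everything the term [al * |grad psi|^2] must beat: [1] from the time derivative, [m2 + 2 * n%:R]
   from the Laplacian of [psi], [C] from the zero-order term, and a last [1] for strictness. *)
pose m1 := 1 + m2 + 2 * n%:R + C + 1.
have m20 : 0 <= m2 by apply: sumr_ge0 => j _; rewrite addr_ge0.
have m10 : 1 <= m1 by rewrite /m1; have := ler0n R n; lra.
(* The lower bound [1 <= al] serves to absorb the zero-order term [C * w] into the common factor
   [G]. *)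
have [al al1 alE] : exists2 al, 1 <= al & al * (gam ^+ 2 / 4) = gam ^+ 2 / 4 + m1.
  exists (1 + 4 * m1 / gam ^+ 2); last by field; rewrite gt_eqF.
  by rewrite lerDl divr_ge0 ?sqr_ge0//; lra.
have al0 : 0 < al by exact: lt_le_trans al1.
pose B := [set p : 'rV[R]_n * R | `|p.1 - z| <= r /\ t0 - r <= p.2 <= t0].
pose K := B `&` [set p | 0 <= psi p.1 p.2].
have cB : compact B by apply: compact_box; exact: ltW.
have cpsi_at p : U p.1 -> psi q.1 q.2 @[q --> p] --> psi p.1 p.2.
  move=> Up; apply: cvgB; last by apply: cvgB; [exact: cvg_cst|exact: cvg_snd].
  apply: cvgB.
    by apply: cvgN; apply: (@cvg_comp _ _ _ fst rho _ (nbhs p.1));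
      [exact: cvg_fst|exact: cr].
  apply: (@continuous_dot_comp _ _ _ (fun q : 'rV[R]_n * R => q.1 - z)) => {Up}p.
  by apply: cvgB; [exact: cvg_fst|exact: cvg_cst].
have cpsi : {within B, continuous (fun p => psi p.1 p.2)}.
  apply/subspace_continuousP => p [/= /rN[Up _ _ _] _].
  by apply: cvg_within_filter; exact: cpsi_at.
have cK : compact K by exact: compact_superlevel.
have KO x t : K (x, t) -> Omega x \/ x = z /\ t = t0.
  move=> [[/= xr tr] p0].
  have [Ux _ _ _] := rN _ xr.
  have [rx|rx] := ltP (rho x) 0; first by left; apply/ins.
  right; have := dot_ge0 (x - z); move: p0; rewrite /psi => p0 d0.
  have tE : t = t0 by apply/le_anti/andP; split; lra.
  split => //; apply/eqP; rewrite -subr_eq0 -normr_eq0 eq_le normr_ge0 andbT.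
  by apply: normr_le_of_dot => //; rewrite expr0n/=; lra.
have Kcyl x t : K (x, t) -> cylinder Omega T (x, t).
  move=> Kxt; have [[/= xr tr] _] := Kxt; split => /=; last lra.
  by have [Ox|[-> _]//] := KO _ _ Kxt; exact: subset_closure.
have KN x t : K (x, t) -> Omega x -> N (x, t).
  by move=> [[/= xr tr] _] Ox; split => //=; lra.
have cuK : {within K, continuous (fun p => u p.1 p.2)}.
  by apply: continuous_subspaceW cu => -[x t]; exact: Kcyl.
(* Within [K], [0 <= far] selects the sides and the bottom of the box. The point [(z, t0)] is not
   there, so [u] has a positive minimum [eta] on that compact part; if the part is empty, any
   positive [eta] will do. *)
pose far (p : 'rV[R]_n * R) := Num.max (`|p.1 - z| - r) (t0 - r - p.2).
have [eta eta0 Heta] : exists2 eta, 0 < eta &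
    forall x t, K (x, t) -> 0 <= far (x, t) -> eta <= u x t.
  have cL : compact (K `&` [set p | 0 <= far p]).
    apply: compact_superlevel => //; apply: continuous_subspaceT.
    apply: max_fun_continuous => p.
      by apply: cvgB; [apply: cvg_norm; apply: cvgB;
        [exact: cvg_fst|exact: cvg_cst]|exact: cvg_cst].
    by apply: cvgB; [exact: cvg_cst|exact: cvg_snd].
  have [L0|/set0P/negP/negPn/eqP L0] := pselect (K `&` [set p | 0 <= far p] !=set0).
    have [|[y s] /set_mem[Kys fys] ym] :=
      compact_EVT_min L0 cL (_ : {within _, continuous (fun p => u p.1 p.2)}).
      by apply: continuous_subspaceW cuK => p [].
    exists (u y s); last by move=> x t Kxt fxt; apply: (ym (x, t)); rewrite inE.
    have [Oy|[yz st]] := KO _ _ Kys; first by apply: uN; exact: KN.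
    by move: fys; rewrite /= /far /= yz st subrr normr0 le_max; lra.
  exists 1 => // x t Kxt fxt; exfalso.
  by have : (K `&` [set p | 0 <= far p]) (x, t) by []; rewrite L0.
(* As [psi <= 1] on the box at times up to [t0], this yields [w <= eta] on [K]. *)
have [ep ep0 epE] : exists2 ep, 0 < ep & ep * expR al = eta.
  exists (eta / expR al); first by rewrite divr_gt0// expR_gt0.
  by rewrite divfK// gt_eqF// expR_gt0.
pose w x t := ep * (expR (al * psi x t) - 1).
have w_le : forall x t, K (x, t) -> w x t <= u x t.
  apply: (comparison cK C0 cuK).
    have cpsiK : {within K, continuous (fun p => psi p.1 p.2)}.
      by apply: continuous_subspaceW cpsi => p [].
    apply/subspace_continuousP => p Kp;
      have /subspace_continuousP/(_ _ Kp) cp := cpsiK.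
    apply: cvgM; first exact: cvg_cst.
    apply: cvgB; last exact: cvg_cst.
    apply: (@cvg_comp _ _ _ (fun p =>
      al * psi p.1 p.2) expR _ (nbhs (al * psi p.1 p.2)));
        last exact: continuous_expR.
    by apply: cvgM => //; exact: cvg_cst.
  move=> x t Kxt uw.
  have [[/= xr tr] p0] := Kxt.
  have [Ux r1 g1 h2] := rN _ xr.
  (* At [(z, t0)] both functions vanish, so [u < w] excludes that point; the sides, the bottom and
     [psi = 0] are excluded below. *)
  have Ox : Omega x.
    have [//|[xz tt]] := KO _ _ Kxt.
    have pz : psi z t0 = 0.
      rewrite /psi rhoz !subrr /dot big1; first by rewrite oppr0 !addr0.
      by move=> j _; rewrite mxE mul0r.
    by move: uw; rewrite xz tt uz /w pz mulr0 expR0 subrr mulr0 ltxx.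
  have tT0 : 0 <= t < T by lra.
  have tT' : 0 < t < T by lra.
  have psi1 : psi x t <= 1.
    have := dot_ge0 (x - z); have := ler_norm (- rho x); rewrite normrN /psi; lra.
  have w_eta : w x t <= eta.
    have h : ep * expR (al * psi x t) <= ep * expR al.
      by rewrite ler_pM2l// ler_expR ler_piMr// ltW.
    by rewrite -epE /w mulrBr mulr1; apply: le_trans h; rewrite gerBl ltW.
  have /andP[xr' tr'] : (`|x - z| - r < 0) && (t0 - r - t < 0).
    rewrite -gt_max ltNge; apply/negP => fxt.
    by have := Heta _ _ Kxt fxt; lra.
  have psi0 : 0 < psi x t.
    rewrite lt_neqAle p0 andbT; apply/eqP => p00.
    have := u_ge0 Ox tT0; move: uw; rewrite /w -p00 mulr0 expR0 subrr mulr0; lra.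
  split.
  - move=> j.
    have n1 : \forall s \near (0 : R), 0 < r - `|x + s *: basis_vec j - z|.
      apply: (@near_line_gt0 _ _ (fun x t => r - `|x - z|) x t); last lra.
      apply: cvgB; first exact: cvg_cst.
      by apply: cvg_norm; apply: cvgB; [exact: cvg_fst|exact: cvg_cst].
    have n2 := near_line_gt0 (basis_vec j) (cpsi_at (x, t) Ux) psi0.
    near=> s; split; last by apply: ltW; near: s.
    split => //=; have : 0 < r - `|x + s *: basis_vec j - z| by near: s.
    lra.
  - have n2 := near_time_gt0 (cpsi_at (x, t) Ux) psi0.
    near=> s => st; split; last by apply: ltW; near: s.
    split => //=.
    have : t0 - r < s by near: s; apply: lt_nbhsr; lra.
    lra.
  pose G := ep * al * expR (al * psi x t).
  have G0 : 0 < G by rewrite !mulr_gt0 ?expR_gt0.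
  pose P j s := psi (x + s *: basis_vec j) t.
  pose D j s := - partial j rho (x + s *: basis_vec j) + (- 2 * (x - z) ord0 j +
    2 * - 1 * s).
  have P0 j : P j 0 = psi x t by rewrite /P scale0r addr0.
  have D0 j : D j 0 = - partial j rho x - 2 * (x - z) ord0 j.
    by rewrite /D scale0r addr0; ring.
  have jr : axis_jet2 rho x (fun j s => partial j rho (x + s *: basis_vec j))
      (fun j => partial j (partial j rho) x).
    apply: (axis_jet2_partial oU Ux) => j y Uy; first exact: (d1rho j).1.
    exact: ((d1rho j).2.2 j).1.
  have dP j : \forall s \near (0 : R), is_derive (s : R) 1 (P j) (D j s).
    have [nj _] := jr j; apply: filterS nj => s ds.
    have -> : P j = (fun s => - rho (x + s *: basis_vec j) +
        ((- dot (x - z) (x - z) - (t0 - t)) + - 2 * (x - z) ord0 j * s + - 1 * s ^+ 2)).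
      apply/funext => h; rewrite /P /psi.
      rewrite (_ : x + _ - z = (x - z) + h *: basis_vec j); last by rewrite addrAC.
      by rewrite dot_add_basis; ring.
    exact: (is_deriveD (is_deriveN ds) (is_derive_quadratic _ _ _ _)).
  have dD j : is_derive (0 : R) 1 (D j) (- partial j (partial j rho) x + 2 * - 1).
    have [_ ds] := jr j.
    exact: (is_deriveD (is_deriveN ds) (is_derive_affine _ _ _)).
  exists (derive1 (u x) t), (fun j s => partial j (u ^~ t) (x + s *: basis_vec j)),
    (fun j => partial j (partial j (u ^~ t)) x), (G * 1),
    (fun j s => ep * al * expR (al * P j s) * D j s),
    (fun j => G * (al * D j 0 ^+ 2 + (- partial j (partial j rho) x + 2 * - 1))).
  split; [exact: (C21_is_derive_t C21u)| |exact: (C21_axis_jet2 oOmega C21u)| |].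
  - apply: is_derive_scaled_expR.
    have -> : psi x = (fun s => (- rho x - dot (x - z) (x - z) - t0) + 1 * s).
      by apply/funext => s; rewrite /psi; ring.
    exact: is_derive_affine.
  - move=> j; split.
      by apply: filterS (dP j) => s; exact: is_derive_scaled_expR.
    have := is_derive2_scaled_expR ep al (nbhs_singleton (dP j)) (dD j).
    by rewrite P0.
  apply: lt_le_trans (_ : _ < 0) _; last by apply: sN; exact: KN.
  pose S1 := \sum_j D j 0 ^+ 2.
  have -> : \sum_j G * (al * D j 0 ^+ 2 + (- partial j (partial j rho) x + 2 * - 1))
      = G * (al * S1 - \sum_j partial j (partial j rho) x - 2 * n%:R).
    rewrite -mulr_sumr big_split /= -mulr_sumr big_split /= sumr_const card_ord
      sumrN.
    by rewrite -mulr_natl /S1; ring.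
  have lap_le : \sum_j partial j (partial j rho) x <= m2.
    by apply: ler_sum => j _; apply: le_trans (ler_norm _) (h2 j).
  have D0i : gam / 2 <= `|D i 0|.
    have xi : `|(x - z) ord0 i| <= r by apply: (normr_rV_le _ (ltW r0)).1.
    have t1 := ler_normD (D i 0 + (partial i rho x - partial i rho z))
      (2 * (x - z) ord0 i).
    have t2 := ler_normD (D i 0) (partial i rho x - partial i rho z).
    have E : D i 0 + (partial i rho x - partial i rho z) + 2 * (x - z) ord0 i
      = - partial i rho z.
      by rewrite D0; ring.
    move: t1; rewrite E normrN -/gam normrM (ger0_norm (ler0n R 2)); lra.
  have S1_ge : gam ^+ 2 / 4 <= S1.
    apply: le_trans (_ : _ <= D i 0 ^+ 2) _; last first.
      by rewrite /S1 (bigD1 i)//= lerDl; apply: sumr_ge0 => j _; exact: sqr_ge0.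
    have -> : gam ^+ 2 / 4 = (gam / 2) ^+ 2 by field.
    by rewrite -[leRHS]real_normK ?num_real// ler_pXn2r// ?nnegrE//; lra.
  have alS : m1 <= al * S1.
    apply: le_trans (_ : _ <= al * (gam ^+ 2 / 4)) _;
      last by rewrite ler_wpM2l// ltW.
    by rewrite alE lerDr divr_ge0// sqr_ge0.
  have Cw : C * w x t <= C * G.
    rewrite ler_wpM2l// /w /G -mulrA ler_wpM2l//; first exact: ltW.
    have : 1 * expR (al * psi x t) <= al * expR (al * psi x t).
      by rewrite ler_wpM2r// expR_ge0.
    lra.
  apply: le_lt_trans (_ : _ <= G * (1 - al * S1 + m2 + 2 * n%:R + C)) _.
    have h := ler_wpM2l (ltW G0) lap_le.
    lra.
  by rewrite pmulr_rlt0//; move: alS; rewrite /m1; lra.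
(* The orientation of the [i]-th axis along which [rho] decreases from [z], that is, the one
   entering [Omega]. *)
pose sg := - Num.sg (partial i rho z).
have sgE : sg * partial i rho z = - gam by rewrite /sg mulNr -normrEsg.
have sg2 : sg ^+ 2 = 1 by rewrite /sg sqrrN sqr_sg gi0.
have sg1 : `|sg| = 1 by rewrite /sg normrN normr_sg gi0.
pose kappa := ep * al * gam / 2.
have kappa0 : 0 < kappa by rewrite /kappa divr_gt0// !mulr_gt0.
have dl : is_derive (0 : R) 1 (fun s => rho (z + (sg * s) *: basis_vec i)) (- gam).
  have E : z + (sg * 0) *: basis_vec i = z by rewrite mulr0 scale0r addr0.
  have /is_derive_scaled_line : derivable rho (z + (sg * 0) *: basis_vec i)
    (basis_vec i).
    by rewrite E; exact: (d1rho i).1.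
  by rewrite E -/(partial i rho z) mulrC sgE.
have cq := is_derive_cvg dl.
(* The slope [3 / 4 * gam] leaves room for the term [s ^+ 2 <= s * (gam / 8)] in [psi], so that
   [psi] still grows at rate [gam / 2]; this explains [kappa]. *)
have q0 : - gam < - (3 / 4 * gam) by lra.
have H : \forall h \near 0^', h^-1 * (rho (z + (sg * (0 + h)) *: basis_vec i) -
    rho (z + (sg * 0) *: basis_vec i)) < - (3 / 4 * gam).
  exact: cvgr_lt cq _ q0.
have [e /= e1 He] := H.
have kg : kappa <= sg * g z t0 ord0 i.
  apply: (@inward_derivative_ge z t0 i sg kappa (Num.min r e)) => //;
    first by rewrite lt_min r0.
  move=> s /andP[s0]; rewrite lt_min => /andP[sr se].
  have := He s; rewrite /ball_/= sub0r normrN (gtr0_norm s0) add0r mulr0 scale0r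
    addr0 rhoz subr0.
  move=> /(_ se); rewrite gt_eqF// => /(_ isT).
  rewrite mulrC ltr_pdivrMr// => rX.
  set X := z + _ in rX *.
  have XB : `|X - z| = s.
    by rewrite /X addrC addKr normrZ normr_basis_vec normrM sg1 mulr1 mul1r
      gtr0_norm.
  have XX : dot (X - z) (X - z) = s ^+ 2.
    have -> : X - z = 0 + (sg * s) *: basis_vec i by rewrite /X add0r addrC addKr.
    rewrite dot_add_basis /dot big1 => [|j _]; last by rewrite mxE mul0r.
    by rewrite mxE mulr0 mul0r !add0r exprMn sg2 mul1r.
  clearbody X.
  have [|UX _ _ _] := rN X; first by rewrite XB ltW.
  have OX : Omega X.
    by apply/ins => //; apply: lt_trans rX _; rewrite mulNr oppr_lt0 !mulr_gt0//;
      lra.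
  split => //.
  have ss : s ^+ 2 <= s * (gam / 8) by rewrite expr2 ler_pM2l//; lra.
  have gs : 0 < gam * s by exact: mulr_gt0.
  have pX : gam * s / 2 <= psi X t0 by rewrite /psi XX subrr; lra.
  have KX : K (X, t0).
    by split; [split => /=; [rewrite XB ltW|lra]|rewrite /=; lra].
  apply: le_trans (w_le _ _ KX); rewrite /w.
  have -> : kappa * s = ep * (al * (gam * s / 2)) by rewrite /kappa; ring.
  rewrite ler_pM2l// lerBrDl; apply: le_trans (expR_ge1Dx _).
  by rewrite lerD2l ler_wpM2l// ltW.
have -> : g z t0 ord0 i * partial i rho z = - gam * (sg * g z t0 ord0 i).
  by rewrite -sgE -[LHS]mul1r -sg2; ring.
by rewrite mulNr oppr_lt0 mulr_gt0//; exact: lt_le_trans kg.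
Unshelve. all: end_near. Qed.

End hopf.

(** * Topology of the domain and of the space-time cylinder *)

Lemma boundary_open (R : realType) n (Omega : set 'rV[R]_n) x :
  open Omega -> boundary Omega x <-> closure Omega x /\ ~ Omega x.
Proof. by move=> /interior_id oO; rewrite /boundary oO. Qed.

Lemma QT_GammaT_cylinder (R : realType) n (Omega : set 'rV[R]_n) (T : R) :
  open Omega -> 0 < T -> QT Omega T `|` GammaT Omega T = cylinder Omega T.
Proof.
move=> oO T0; apply/seteqP; split=> [[x t]|[x t] /= [cx tT]].
  move=> [[/= Ox tT]|[[/= [cx _] tT]|[/= cx ->]]]; split => //=; rewrite ?lexx//.
  - exact: subset_closure.
  - lra.
  - lra.
have [t0|t0] := eqVneq t 0; first by right; right.
have tT' : 0 < t < T by rewrite lt_neqAle eq_sym t0.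
have [Ox|nOx] := pselect (Omega x); first by left; split.
by right; left; split => //=; apply/boundary_open.
Qed.

Lemma open_closed_ball (R : realType) n (Omega : set 'rV[R]_n) x :
  open Omega -> Omega x ->
  exists2 r, 0 < r & forall y, `|y - x| <= r -> Omega y.
Proof.
move=> oO Ox; have /nbhs_ballP[e /= e0 He] := open_nbhs_nbhs (conj oO Ox).
exists (e / 2); first by lra.
by move=> y yx; apply: He; rewrite -ball_normE /ball_/= distrC; lra.
Qed.

Lemma closure_ballP (R : realType) n (A : set 'rV[R]_n) x e :
  closure A x -> 0 < e -> exists2 y, A y & `|y - x| < e.
Proof.
move=> cA e0; have [y [Ay]] := cA _ (nbhsx_ballx x e e0).
by rewrite -ball_normE /ball_/= distrC => xy; exists y.
Qed.

Lemma compact_closure (R : realType) n (A : set 'rV[R]_n) :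
  bounded_set A -> compact (closure A).
Proof.
move=> [M [_ HM]]; apply: bounded_closed_compact; last exact: closed_closure.
exists (M + 2); split; first exact: num_real.
move=> r Mr x cx /=.
have [y Ay xy] := closure_ballP cx ltr01.
have yM : `|y| <= M + 1 by apply: (HM (M + 1)) => //; lra.
have := ler_normD (x - y) y; rewrite subrK distrC; lra.
Qed.

Lemma compact_cylinder (R : realType) n (A : set 'rV[R]_n) (b : R) :
  bounded_set A ->
  compact [set z : 'rV[R]_n * R | closure A z.1 /\ 0 <= z.2 <= b].
Proof.
move=> bA; set S := (X in compact X).
have -> : S = closure A `*` `[0, b]%classic.
  by apply/seteqP; split => -[x t] /= [cx tb]; split => //=; move: tb;
    rewrite in_itv.
by apply: compact_setX; [exact: compact_closure|exact: segment_compact].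
Qed.

(** * Positivity on the whole domain and the sign of the normal derivative *)

Section positivity.
Context {R : realType} {n : nat} (Omega : set 'rV[R]_n) (T : R)
  (u : 'rV[R]_n -> R -> R).
Hypotheses (oOmega : open Omega) (C21u : C21 Omega T u).
Hypothesis cu : {within cylinder Omega T, continuous (fun z => u z.1 z.2)}.
Hypothesis u_ge0 : forall x t, Omega x -> 0 <= t < T -> 0 <= u x t.

(** The set of points where [u] is positive at all times in []0, T[] contains [x0] and is open and
    relatively closed in [Omega], because positivity at an earlier time spreads over balls of a
    fixed size. *)
Lemma positivity_connected x0 : connected Omega -> Omega x0 -> 0 < u x0 0 ->
  (forall t, 0 < t < T -> exists2 C, 0 <= C &
     supersolution [set z | Omega z.1 /\ 0 < z.2 <= t] C u) ->
  forall x t, Omega x -> 0 < t < T -> 0 < u x t.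
Proof.
move=> cO Ox0 ux0 Su.
have step x1 x2 r s t : 0 < r -> (forall y, `|y - x1| <= 2 * r -> Omega y) ->
    `|x2 - x1| <= r -> 0 <= s -> s < t -> t < T -> 0 < u x1 s -> 0 < u x2 t.
  move=> r0 HO x21 s0 st tT.
  have [|C C0 SC] := Su t; first by lra.
  apply: (propagation oOmega C21u cu u_ge0 C0 r0) => // x t' [/= xx tt].
  by apply: SC; split => /=; [exact: HO|lra].
pose A := [set x | Omega x /\ forall t, 0 < t < T -> 0 < u x t].
suff AO : A = Omega by move=> x t; rewrite -AO => -[_]; exact.
(* With the factor [3], a ball of radius [2 * r] about any point within [r] of [x] still lies in
   [Omega], as relative closedness requires. *)
have ball2 x : Omega x -> exists2 r, 0 < r & forall y, `|y - x| <= 3 * r -> Omega y.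
  move=> Ox; have [r r0 Hr] := open_closed_ball oOmega Ox.
  by exists (r / 3) => [|y yx]; [lra|apply: Hr; lra].
have near_A x y r : 0 < r -> (forall y, `|y - x| <= 2 * r -> Omega y) -> A x ->
    `|y - x| <= r -> A y.
  move=> r0 HO [Ox ux] yx; split; first by apply: HO; lra.
  (* Moving from [x] to [y] takes positive time, so the positivity of [u x] is used at [t / 2]. *)
  move=> t tT; apply: (step x y r (t / 2) t) => //; try lra.
  by apply: ux; lra.
apply: cO.
- exists x0; split => // t tT.
  have [r r0 HO] := ball2 _ Ox0.
  apply: (step x0 x0 r 0 t) => //; rewrite ?subrr ?normr0; try lra.
  by move=> y yx; apply: HO; lra.
- exists A; last by rewrite setIidr// => x [].
  rewrite openE => x Ax; have [Ox _] := Ax.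
  have [r r0 HO] := ball2 _ Ox.
  apply/nbhs_ballP; exists r => //= y; rewrite -ball_normE /ball_/= distrC => yx.
  by apply: (near_A x y r) => //; [move=> z zx; apply: HO; lra|exact: ltW].
- exists (closure A); first exact: closed_closure.
  apply/seteqP; split => [x Ax|x [Ox cAx]].
    by split; [case: Ax|exact: subset_closure].
  have [r r0 HO] := ball2 _ Ox.
  have [y Ay yx] := closure_ballP cAx r0.
  apply: (near_A y x r) => //; last by rewrite distrC ltW.
  move=> z zy; apply: HO.
  have := ler_normD (z - y) (y - x); rewrite addrA subrK; lra.
Qed.

Variable g : 'rV[R]_n -> R -> 'rV[R]_n.
Hypothesis gu : forall x t, Omega x -> 0 <= t < T -> gradient (u ^~ t) x = g x t.
Hypothesis cg : {within cylinder Omega T, continuous (fun z => g z.1 z.2)}.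

(** By [hopf] every axis with a nonzero component of [gradient rho z] contributes a negative term to
    the dot product, the other axes contribute zero, and regularity of [rho] provides at least one
    nonzero component. *)
Lemma hopf_normal C z v t0 e0 :
  unit_outward_normal_at Omega z v -> boundary Omega z -> 0 < t0 < T ->
  0 <= C -> u z t0 = 0 -> 0 < e0 ->
  let N := [set p | [/\ Omega p.1, `|p.1 - z| <= e0 & t0 - e0 <= p.2 <= t0]] in
  (forall x t, N (x, t) -> 0 < u x t) -> supersolution N C u ->
  dot (g z t0) v < 0.
Proof.
move=> [U [rho [L ->]]] bz tT C0 uz e00 N uN sN.
have := ldf_regular L (ldf_mem L) bz; rewrite -normr_gt0.
move=> grho; set c := euclidean_norm _.
have Hi i := hopf oOmega C21u cu gu cg u_ge0 (i := i) L bz tT C0 uz e00 uN sN.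
have [i gi] : exists i, partial i rho z != 0.
  apply/existsP; apply: contraTT grho => /existsPn H.
  rewrite normr_gt0 negbK; apply/eqP/rowP => i; rewrite !mxE.
  by apply/eqP; have := H i; rewrite negbK.
have c0 : 0 < c.
  rewrite /c /euclidean_norm sqrtr_gt0.
  apply: lt_le_trans (coord_sqr_le_dot _ i).
  by rewrite mxE exprn_even_gt0.
have -> : dot (g z t0) (c^-1 *: gradient rho z)
    = c^-1 * \sum_i g z t0 ord0 i * partial i rho z.
  by rewrite /dot mulr_sumr; apply: eq_bigr => j _; rewrite !mxE; ring.
rewrite pmulr_rlt0 ?invr_gt0// (bigD1 i)//=.
rewrite -[X in _ < X]addr0; apply: ltr_leD; first exact: Hi.
apply: sumr_le0 => j _.
by have [->|/Hi/ltW//] := eqVneq (partial j rho z) 0; rewrite mulr0.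
Qed.
End positivity.

(** * Lower bound for the memory integral and power inequalities *)

Lemma lebesgue_segment (R : realType) (t : R) : 0 <= t ->
  lebesgue_measure `[0, t]%classic = t%:E.
Proof.
move=> t0; rewrite lebesgue_measure_itv/= lte_fin.
by case: ltgtP t0 => //= [_ _|<- _]; rewrite ?oppr0 ?adde0.
Qed.

(** The integrand is nonnegative, so the part over [[0, s]] already gives the bound; the upper bound
    [M] supplies integrability. *)
Lemma le_Rintegral_powR (R : realType) (f : R -> R) (q s t eta M : R) :
  {within `[0, t], continuous f} -> 0 < q -> 0 <= s <= t -> 0 <= eta ->
  (forall r, 0 <= r <= t -> 0 <= f r <= M) ->
  (forall r, 0 <= r <= s -> eta <= f r) ->
  eta `^ q * s <= \int[lebesgue_measure]_(r in `[0, t]) (f r `^ q).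
Proof.
move=> cf q0 st eta0 fM fs.
have mf : measurable_fun `[0, t] (fun r => f r `^ q).
  apply: (measurableT_comp (measurable_powR q)).
  exact: subspace_continuous_measurable_fun.
have If : lebesgue_measure.-integrable `[0, t] (EFin \o (fun r => f r `^ q)).
  apply: measurable_bounded_integrable => //.
    by move: (ltry t); rewrite -lebesgue_segment//; lra.
  exists (M `^ q); split; first exact: num_real.
  move=> N /ltW MN r /=; rewrite in_itv/= => rt; apply: le_trans MN.
  have /andP[f0 fM'] := fM _ rt.
  rewrite ger0_norm ?powR_ge0//; apply: ge0_ler_powR => //; rewrite ?nnegrE//;
    first exact: ltW.
  exact: le_trans fM'.
have st' : `[0, s] `<=` `[0, t]%classic.
  by move=> r /=; rewrite !in_itv/=; lra.
apply: le_trans (_ : _ <= \int[lebesgue_measure]_(r in `[0, s]) (f r `^ q)) _.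
  have -> : eta `^ q * s = \int[lebesgue_measure]_(r in `[0, s]) (eta `^ q).
    by rewrite Rintegral_cst//= lebesgue_segment//; lra.
  apply: le_Rintegral => //.
  - apply: measurable_bounded_integrable => //.
      by move: (ltry s); rewrite -lebesgue_segment//; lra.
    by exists `|eta `^ q|; split; [exact: num_real|move=> N /ltW MN r _].
  - exact: integrableS If.
  - move=> r /=; rewrite in_itv/= => rs.
    have := fs _ rs => h.
    by apply: ge0_ler_powR => //; rewrite ?nnegrE//; [exact: ltW|exact: le_trans h].
rewrite /Rintegral; apply: fine_le.
- by apply: integrable_fin_num => //; exact: integrableS If.
- exact: integrable_fin_num.
- apply: ge0_subset_integral => //; first exact/measurable_EFinP.
  by move=> r _; rewrite lee_fin powR_ge0.
Qed.

(** Turns the absorption term into a linear one on a bounded range of values. *)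
Lemma powR_le_linear (R : realType) (v M m : R) :
  0 <= v <= M -> 1 <= m -> v `^ m <= M `^ (m - 1) * v.
Proof.
move=> /andP[v0 vM] m1.
have [->|vn0] := eqVneq v 0; first by rewrite powR0 ?mulr0//; lra.
have -> : v `^ m = v `^ (m - 1) * v.
  rewrite -[X in _ * X]powRr1// -powRD ?vn0 ?implybT//; congr (_ `^ _); lra.
apply: ler_wpM2r => //.
by apply: ge0_ler_powR => //; rewrite ?nnegrE//; [lra|exact: le_trans vM].
Qed.

(** Lets the source term of power [p] dominate the absorption for small values. The value [0] is
    separate since the exponents add only for a nonzero base. *)
Lemma powR_le_lower_power (R : realType) (v d p m : R) :
  0 <= v <= d -> 0 <= p -> p < m -> v `^ m <= d `^ (m - p) * v `^ p.
Proof.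
move=> /andP[v0 vd] p0 pm.
have [->|vn0] := eqVneq v 0.
  rewrite (powR0 (_ : m != 0)); last by rewrite gt_eqF//; exact: le_lt_trans pm.
  by rewrite mulr_ge0// powR_ge0.
have -> : v `^ m = v `^ (m - p) * v `^ p.
  by rewrite -powRD ?vn0 ?implybT// subrK.
apply: ler_wpM2r; first exact: powR_ge0.
by apply: ge0_ler_powR => //; rewrite ?nnegrE//; [lra|exact: le_trans vd].
Qed.

(** * The two positivity statements for solutions of the problem *)

Unset Implicit Arguments.

Theorem lemma1 (R : realType) (n : nat) (hn : (1 <= n)%N)
  (Omega : set 'rV[R]_n) (nu : 'rV[R]_n -> 'rV[R]_n)
  (hOmega : bounded_domain Omega) (hsmooth : smooth_boundary Omega)
  (hnu : unit_outward_normal Omega nu)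
  (p q m l a b : R)
  (hp : 0 <= p) (hq : 0 < q) (hm : 0 < m) (hl : 0 < l) (ha : 0 < a) (hb : 0 < b)
  (k : 'rV[R]_n -> 'rV[R]_n -> R -> R) (hk : admissible_kernel Omega k)
  (u0 : 'rV[R]_n -> R) (hu0 : admissible_initial_datum Omega nu l k u0)
  (T : R) (hT : 0 < T) (u : 'rV[R]_n -> R -> R)
  (hu : solution Omega nu p q m l a b k u0 T u) :
  ((exists2 x, Omega x & u0 x <> 0) -> 1 <= m ->
     forall x t, (QT Omega T `|` ST Omega T) (x, t) -> 0 < u x t) /\
  ((forall x, closure Omega x -> 0 < u0 x) -> p < m < 1 ->
     forall x t, (QT Omega T `|` GammaT Omega T) (x, t) -> 0 < u x t).
Proof.
case: hOmega => [[xO OxO] oO cO bO].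
case: hu => uge0' C21u eqn [g [[cu' _ gu cg'] bc]] init.
case: hu0 => u00 [g0 [[cu0 _ _ _] _]].
move: uge0' cu' cg'; rewrite (QT_GammaT_cylinder oO hT) => uge0 cu cg.
have u_ge0 x t : Omega x -> 0 <= t < T -> 0 <= u x t.
  by move=> Ox tT; apply: uge0; split => //; exact: subset_closure.
have bc_ge0 z t : boundary Omega z -> 0 < t < T -> 0 <= dot (g z t) (nu z).
  move=> bz tT; rewrite (bc _ _ (conj bz tT)); apply: Rintegral_ge0 => y Oy.
  apply: mulr_ge0; last exact: powR_ge0.
  by apply: hk.2; split => //=; [exact: subset_closure|lra].
have no_boundary_zero z t0 C e0 : boundary Omega z -> 0 < t0 < T -> 0 <= C ->
    0 < e0 ->
    (forall x t, Omega x -> t0 - e0 <= t <= t0 -> 0 < u x t) ->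
    supersolution [set x | [/\ Omega x.1,
      `|x.1 - z| <= e0 & t0 - e0 <= x.2 <= t0]] C u ->
    u z t0 <> 0.
  move=> bz tT C0 e00 up Su uz.
  suff : dot (g z t0) (nu z) < 0 by rewrite ltNge bc_ge0.
  have H := hopf_normal oO C21u cu u_ge0 gu cg (hnu _ bz) bz tT C0 uz e00.
  by apply: H Su => x t [/= Ox _ tt]; exact: up.
(* Compactness is used on times up to [t < T], as no bound is available up to [T]. *)
have bound t : 0 < t < T -> exists2 M, 0 <= M &
    forall x s, closure Omega x -> 0 <= s <= t -> 0 <= u x s <= M.
  move=> tT; have cK := @compact_cylinder _ _ _ t bO.
  have [||[c r] /set_mem[/= cc rt] mc] :=
    compact_EVT_max _ cK (_ : {within _, continuous (fun z => u z.1 z.2)}).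
  - by exists (xO, 0); split => /=; [exact: subset_closure|lra].
  - by apply: continuous_subspaceW cu => -[x s] [/= cx st]; split => //=; lra.
  have ur : 0 <= u c r by apply: uge0; split => //=; lra.
  exists (u c r) => // x s cx st; apply/andP; split.
    by apply: uge0; split => //=; lra.
  by apply: (mc (x, s)); rewrite inE; split.
split.
- move=> [x0 Ox0 /eqP ux0] m1.
  have Su t : 0 < t < T -> exists2 C, 0 <= C &
      supersolution [set z | Omega z.1 /\ 0 < z.2 <= t] C u.
    move=> tT; have [M M0 HM] := bound _ tT.
    exists (b * M `^ (m - 1)); first by rewrite mulr_ge0 ?powR_ge0// ltW.
    move=> x s [/= Ox st]; rewrite eqn; last by split => //=; lra.
    have uM : 0 <= u x s <= M by apply: HM; [exact: subset_closure|lra].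
    have h : b * u x s `^ m <= b * (M `^ (m - 1) * u x s).
      by rewrite ler_pM2l//; exact: powR_le_linear.
    have : 0 <= a * u x s `^ p * \int[lebesgue_measure]_(tau in `[0,
      s]) (u x tau `^ q).
      rewrite mulr_ge0//; first by rewrite mulr_ge0 ?powR_ge0// ltW.
      by apply: Rintegral_ge0 => r _; exact: powR_ge0.
    move: h; lra.
  have u0x0 : 0 < u x0 0 by rewrite init// lt_neqAle eq_sym ux0 u00.
  have pos := positivity_connected oO C21u cu u_ge0 cO Ox0 u0x0 Su.
  move=> x t [[/= Ox tT]|[/= bx tT]]; first exact: pos.
  have [C C0 SC] := Su _ tT.
  have ux : 0 <= u x t by apply: uge0; split => /=; [case: bx|lra].
  rewrite lt_neqAle ux andbT eq_sym; apply/eqP.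
  (* A time window of length [t / 2] stays away from time [0], where [u] may vanish. *)
  have t2 : 0 < t / 2 by lra.
  apply: (no_boundary_zero x t C (t / 2)) => //.
    by move=> y s Oy st; apply: pos => //; lra.
  by move=> y s [/= Oy _ st]; apply: SC; split => //=; lra.
move=> u0pos /andP[pm _].
(* The initial condition is prescribed on [Omega] only; continuity of [u0] and [u] carries it to the
   closure. *)
have init_pos x : closure Omega x -> 0 < u x 0.
  move=> cx; rewrite ltNge; apply/negP => ux.
  have D0 : cylinder Omega T (x, 0) by split => //=; lra.
  have c2 : {within cylinder Omega T, continuous (fun z => u0 z.1 - u z.1 z.2)}.
    have c0 : {within cylinder Omega T, continuous (u0 \o fst)}.
      by apply: (continuous_within_comp cu0) => [z|z []//]; exact: cvg_fst.
    by move=> z; apply: continuousB; [exact: c0|exact: cu].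
  have ux' : 0 < u0 x - u x 0 by have := u0pos _ cx; lra.
  have [e e0 He] := @within_continuous_gt _ _ _ (fun x t =>
    u0 x - u x t) _ _ _ c2 D0 ux'.
  have [y Oy yx] := closure_ballP cx e0.
  have := He y 0; rewrite init// !subrr normr0 ltxx => h.
  have : false by apply: h => //; split => /=; [exact: subset_closure|lra].
  by [].
move=> x1 t1 [/= cx1 t1T].
rewrite ltNge; apply/negP => u1.
pose D := [set z : 'rV[R]_n * R | closure Omega z.1 /\ 0 <= z.2 <= t1].
have cD : {within D, continuous (fun z => - u z.1 z.2)}.
  have cD : {within D, continuous (fun z => u z.1 z.2)}.
    by apply: continuous_subspaceW cu => -[x t] [/= cx tt]; split => //=; lra.
  by move=> z; apply: continuousN; exact: cD.
have cZ := compact_superlevel (@compact_cylinder _ _ _ t1 bO) cD.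
(* A zero with the least possible time, found by minimizing [snd] on the compact set where
   [0 <= - u]. *)
have [||[x0 t0] /set_mem[[/= cx0 t01] u0le] mZ] :=
  compact_EVT_min _ cZ (_ : {within _, continuous snd}).
- by exists (x1, t1); split => /=; [split => //=; lra|lra].
- by apply: continuous_subspaceT => z; exact: cvg_snd.
have t0T : 0 <= t0 < T by lra.
have ux0 : u x0 t0 = 0.
  by apply/le_anti; rewrite (uge0 _ _ (conj cx0 t0T)) andbT; lra.
have pos x t : closure Omega x -> 0 <= t < t0 -> 0 < u x t.
  move=> cx tt; rewrite ltNge; apply/negP => ux.
  have : t0 <= t by apply: (mZ (x, t)); rewrite inE; split => /=; [split => //=;
    lra|lra].
  lra.
have t00 : 0 < t0.
  rewrite lt_neqAle (andP t0T).1 andbT; apply/eqP => t0E.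
  by move: ux0; rewrite -t0E => ux; have := init_pos _ cx0; rewrite ux ltxx.
have t0T' : 0 < t0 < T by lra.
have [M M0 HM] := bound _ t0T'.
(* Half of the time before the first zero gives a uniform lower bound on [u], hence the lower bound
   [c] on the memory integral at all times in [[t0 / 2, t0]]. *)
have [eta eta0 Heta] : exists2 eta, 0 < eta &
    forall x t, closure Omega x -> 0 <= t <= t0 / 2 -> eta <= u x t.
  have cK := @compact_cylinder _ _ _ (t0 / 2) bO.
  have [||[c r] /set_mem[/= cc rt] mc] :=
    compact_EVT_min _ cK (_ : {within _, continuous (fun z => u z.1 z.2)}).
  - by exists (xO, 0); split => /=; [exact: subset_closure|lra].
  - by apply: continuous_subspaceW cu => -[x s] [/= cx st]; split => //=; lra.
  exists (u c r); first by apply: pos => //; lra.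
  by move=> x s cx st; apply: (mc (x, s)); rewrite inE; split.
pose c := eta `^ q * (t0 / 2).
have c0 : 0 < c by rewrite mulr_gt0 ?powR_gt0//; lra.
have int_ge x t : Omega x -> t0 / 2 <= t <= t0 ->
    c <= \int[lebesgue_measure]_(tau in `[0, t]) (u x tau `^ q).
  move=> Ox tt; have cx : closure Omega x by exact: subset_closure.
  apply: (@le_Rintegral_powR _ _ _ _ _ _ M) => //; try lra.
  - apply: (continuous_within_comp (h := fun s => (x, s)) cu).
      by apply: continuous_pair => s; [exact: cvg_cst|exact: cvg_id].
    by move=> s; rewrite /= in_itv/= => st; split => //=; lra.
  - by move=> r rt; apply: HM => //; lra.
  - by move=> r rt; exact: Heta.
pose d := (a * c / b) `^ ((m - p)^-1).
have acb : 0 < a * c / b by rewrite divr_gt0// mulr_gt0.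
have d0 : 0 < d by rewrite powR_gt0.
have dE : b * d `^ (m - p) = a * c.
  rewrite /d -powRrM mulVf ?powRr1 ?(ltW acb)//; last by rewrite gt_eqF// subr_gt0.
  by rewrite mulrC divfK// gt_eqF.
have local x : closure Omega x -> u x t0 = 0 -> exists2 e0, 0 < e0 <= t0 / 2 &
    supersolution [set z | [/\ Omega z.1,
      `|z.1 - x| <= e0 & t0 - e0 <= z.2 <= t0]] 0 u.
  move=> cx ux.
  have cN : {within cylinder Omega T, continuous (fun z => - u z.1 z.2)}.
    by move=> z; apply: continuousN; exact: cu.
  have ud : - d < - u x t0 by rewrite ux; lra.
  have [e e0 He] := @within_continuous_gt _ _ _ (fun x t =>
    - u x t) _ _ _ cN (conj cx t0T) ud.
  (* The first entry keeps [u] below [d], the second keeps times above [t0 / 2], where [int_ge]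
     holds. *)
  exists (Num.min (e / 2) (t0 / 2)).
    by rewrite lt_min ge_min lexx orbT andbT; lra.
  move=> y s [/= Oy]; rewrite le_min => /andP[ye _] /andP[st s0].
  have es : t0 - e / 2 <= s.
    by apply: le_trans st; rewrite lerB// ge_min lexx.
  have ts : t0 / 2 <= s.
    apply: le_trans st; rewrite lerBrDl -lerBrDr ge_min; apply/orP; right; lra.
  have sT : 0 <= s < T by lra.
  have cy : closure Omega y by exact: subset_closure.
  have uy : u y s < d.
    have : - d < - u y s.
      apply: He; [by split|lra|].
      by rewrite distrC ger0_norm; lra.
    lra.
  rewrite eqn; last by split => //=; lra.
  have us : 0 <= u y s <= d by rewrite u_ge0// ltW.
  have h1 : b * u y s `^ m <= b * (d `^ (m - p) * u y s `^ p).
    by rewrite ler_pM2l//; exact: powR_le_lower_power.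
  have h2 : a * u y s `^ p * c <= a * u y s `^ p *
      \int[lebesgue_measure]_(tau in `[0, s]) (u y tau `^ q).
    apply: ler_wpM2l; first by rewrite mulr_ge0 ?powR_ge0// ltW.
    by apply: int_ge => //; lra.
  have h3 : b * (d `^ (m - p) * u y s `^ p) = a * u y s `^ p * c.
    by rewrite mulrA dE; ring.
  lra.
have interior x : Omega x -> u x t0 <> 0.
  move=> Ox ux; have cx : closure Omega x by exact: subset_closure.
  have [e0 e0t Se] := local _ cx ux.
  have [r r0 Hr] := open_closed_ball oO Ox.
  pose rho := Num.min r e0 / 2.
  have rho0 : 0 < rho by rewrite divr_gt0// lt_min r0; lra.
  have r2 y : `|y - x| <= 2 * rho -> `|y - x| <= r /\ `|y - x| <= e0.
    by rewrite /rho mulrC divfK// le_min => /andP[].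
  suff : 0 < u x t0 by rewrite ux ltxx.
  (* The segment is vertical here: positivity at [(x, t0 - e0)] reaches the same point at time [t0],
     with [C = 0]. *)
  apply: (propagation oO C21u cu u_ge0 (lexx 0) rho0 (x0 := x) (t0 :=
    t0 - e0)) => //.
  - by move=> y /r2[yr _]; exact: Hr.
  - by rewrite subrr normr0 ltW.
  - lra.
  - lra.
  - lra.
  - move=> y s [/= /r2[yr ye] st]; apply: Se; split => //=; first exact: Hr.
    lra.
  - by apply: pos => //; lra.
have [Ox0|nOx0] := pselect (Omega x0); first exact: interior ux0.
have bx0 : boundary Omega x0 by apply/boundary_open.
have [e0 e0t Se] := local _ cx0 ux0.
apply: (no_boundary_zero x0 t0 0 e0) => //; first by lra.
move=> y s Oy /andP[s1 s2].
(* The window of [no_boundary_zero] includes time [t0] itself, where the absence of interior zeros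
   has just been proved. *)
have [st|st] := ltP s t0; first by apply: pos; [exact: subset_closure|lra].
have -> : s = t0 by apply/le_anti/andP.
by rewrite lt_neqAle eq_sym u_ge0// andbT; apply/eqP; exact: interior.
Qed.
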